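(* Let $\mathbb{k}$ be a field and let $\mathcal{H}=(V,\mathcal{E})$ be a (finite, simple) hypergraph. Then $$\operatorname{proj-dim}(\mathcal{H})\leq \operatorname{reg}(\mathcal{L}(\mathcal{H})),$$ where $\mathcal{L}(\mathcal{H})$ is the Levi graph of $\mathcal{H}$.
   Context: A hypergraph $\mathcal{H}=(V,\mathcal{E})$ consists of a finite set $V$ and a set $\mathcal{E}$ of subsets of $V$ (edges), each having at least two elements; it is simple if no edge is contained in another edge. Graphs are finite, without loops or multiple edges, and are regarded as hypergraphs all of whose edges have two elements. The Levi graph $\mathcal{L}(\mathcal{H})$ is the bipartite graph on $V\cup\mathcal{E}$ in which $x\in V$ is adjacent to $F\in\mathcal{E}$ if and only if $x\in F$. Fix a field $\mathbb{k}$ and let $R=\mathbb{k}[V]$ be the polynomial ring with variables the elements of $V$. The edge ideal $I_{\mathcal{H}}\subseteq R$ is generated by the squarefree monomials $\prod_{x\in F}x$, $F\in\mathcal{E}$. For a finitely generated graded $R$-module $M$ with graded Betti numbers $\beta_{i,j}(M)$, $\operatorname{reg}(M)=\max\{j-i:\beta_{i,j}(M)\ne 0\}$ and $\operatorname{proj-dim}(M)=\max\{i:\beta_{i,j}(M)\neq 0 \text{ for some } j\}$. One sets $\operatorname{reg}(\mathcal{H}):=\operatorname{reg}(R/I_{\mathcal{H}})$ and $\operatorname{proj-dim}(\mathcal{H}):=\operatorname{proj-dim}(R/I_{\mathcal{H}})$. *)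

(* Defs.v *)
From HB Require Import structures.
From mathcomp Require Import all_boot all_order all_algebra.
From mathcomp Require Import mpoly.
From Stdlib Require Import ClassicalEpsilon.
Set Implicit Arguments.
Unset Strict Implicit.
Unset Printing Implicit Defensive.
Import Order.TTheory GRing.Theory Num.Theory.
Local Open Scope ring_scope.

Record hypergraph := Hypergraph {
  hvertex : finType;
  hedges : {set {set hvertex}};
  hedges_ge2 : forall F : {set hvertex}, F \in hedges -> (1 < #|F|)%N }.

Definition simple_hypergraph (H : hypergraph) : Prop :=
  forall E F : {set hvertex H},
    E \in hedges H -> F \in hedges H -> E \subset F -> E = F.

Record graph := Graph {
  gvertex : finType;
  gadj : rel gvertex;
  gadj_sym : ssrbool.symmetric gadj;
  gadj_irr : irreflexive gadj }.

Section HypergraphOfGraph.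
Variable G : graph.

Definition graph_edges : {set {set gvertex G}} :=
  [set F | [exists x, exists y, gadj x y && (F == [set x; y])]].

Lemma graph_edges_ge2 (F : {set gvertex G}) :
  F \in graph_edges -> (1 < #|F|)%N.
Proof.
rewrite inE => /existsP [x] /existsP [y] /andP [xy /eqP ->].
by rewrite cards2; case: eqVneq xy => // ->; rewrite gadj_irr.
Qed.

Definition hypergraph_of_graph : hypergraph := Hypergraph graph_edges_ge2.
End HypergraphOfGraph.

Coercion hypergraph_of_graph : graph >-> hypergraph.

Section Levi.
Variable H : hypergraph.

Definition levi_vertex : finType :=
  (hvertex H + {F : {set hvertex H} | F \in hedges H})%type.

Definition levi_adj : rel levi_vertex := fun a b =>
  match a, b with
  | inl x, inr F | inr F, inl x => x \in val F
  | _, _ => false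
  end.

Lemma levi_adj_sym : ssrbool.symmetric levi_adj.
Proof. by move=> [x|F] [y|E]. Qed.

Lemma levi_adj_irr : irreflexive levi_adj.
Proof. by move=> [x|F]. Qed.

Definition levi : graph := Graph levi_adj_sym levi_adj_irr.
End Levi.

(* k[V] is {mpoly k[#|V|]}, the element x of V being the variable of index
   [enum_rank x]. *)
Definition edge_monomial (k : fieldType) (V : finType) (F : {set V}) :
    {mpoly k[#|V|]} :=
  \prod_(x in F) 'X_(enum_rank x).

Definition edge_ideal (k : fieldType) (H : hypergraph)
    (p : {mpoly k[#|hvertex H|]}) : Prop :=
  exists c : {set hvertex H} -> {mpoly k[#|hvertex H|]},
    p = \sum_(F in hedges H) c F * edge_monomial k F.

(* True of the zero polynomial for every d : int. *)
Definition homog_of_degree (k : fieldType) (n : nat) (d : int)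
    (p : {mpoly k[n]}) : Prop :=
  forall m : 'X_{1..n}, m \in msupp p -> (mdeg m)%:Z = d.

(* The data of a sequence of maps of free modules
     ... -> F_2 -> F_1 -> F_0 -> R,      R = k[X_1, ..., X_n],
   where F_i has a basis of [fr_rank i] elements of degrees [fr_deg]; elements
   of F_i are row vectors, on which the maps act by right multiplication. *)
Record free_seq (k : fieldType) (n : nat) := FreeSeq {
  fr_rank : nat -> nat;
  fr_deg : forall i : nat, 'I_(fr_rank i) -> int;
  fr_diff : forall i : nat, 'M[{mpoly k[n]}]_(fr_rank i.+1, fr_rank i);
  fr_aug : 'cV[{mpoly k[n]}]_(fr_rank 0) }.

Definition zero_seq (k : fieldType) (n : nat) : free_seq k n :=
  FreeSeq (fr_rank := fun=> 0%N) (fun _ _ => 0) (fun=> 0) 0.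

(* F is a graded free resolution of R/I, by finitely generated free modules
   and maps of degree 0; the augmentation F_0 -> R/I is [fr_aug] modulo I. *)
Record is_graded_free_resolution (k : fieldType) (n : nat)
    (I : {mpoly k[n]} -> Prop) (F : free_seq k n) : Prop := {
  res_aug_homog : forall c : 'I_(fr_rank F 0),
    homog_of_degree (fr_deg c) (fr_aug F c 0);
  res_diff_homog : forall (i : nat) (r : 'I_(fr_rank F i.+1))
      (c : 'I_(fr_rank F i)),
    homog_of_degree (fr_deg r - fr_deg c) (fr_diff F i r c);
  res_aug_surj : forall p : {mpoly k[n]},
    exists u : 'rV_(fr_rank F 0), I (p - (u *m fr_aug F) 0 0);
  res_exact0 : forall u : 'rV_(fr_rank F 0),
    I ((u *m fr_aug F) 0 0) <->
    exists v : 'rV_(fr_rank F 1), u = v *m fr_diff F 0;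
  res_exact : forall (i : nat) (u : 'rV_(fr_rank F i.+1)),
    u *m fr_diff F i = 0 <->
    exists v : 'rV_(fr_rank F i.+2), u = v *m fr_diff F i.+1 }.

(* Homology of F (x)_R k: modulo the variables, each matrix entry becomes its
   constant term.  Subspaces of F_i (x) k are row spaces of matrices. *)
Section TensorResidueField.
Variables (k : fieldType) (n : nat) (F : free_seq k n).

Definition tens_diff (i : nat) : 'M[k]_(fr_rank F i.+1, fr_rank F i) :=
  map_mx (fun p : {mpoly k[n]} => p@_0%MM) (fr_diff F i).

Definition tens_degree (i : nat) (j : int) : 'M[k]_(fr_rank F i) :=
  diag_mx (\row_(l < fr_rank F i) (fr_deg l == j)%:R).

Definition tens_cycles (i : nat) : 'M[k]_(fr_rank F i) :=
  match i with
  | 0 => 1%:M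
  | i'.+1 => kermx (tens_diff i')
  end.

(* [A :\: B] is a complement of [A :&: B] in A, so this is the dimension of
   the degree j cycles modulo the degree j boundaries. *)
Definition tens_homology_dim (i : nat) (j : int) : nat :=
  \rank ((tens_degree i j :&: tens_cycles i)
         :\: (tens_degree i.+1 j *m tens_diff i))%MS.
End TensorResidueField.

(* R/I has such a resolution when I is a homogeneous ideal; Tor does not
   depend on which one computes it. *)
Definition chosen_resolution (k : fieldType) (n : nat)
    (I : {mpoly k[n]} -> Prop) : free_seq k n :=
  epsilon (inhabits (zero_seq k n)) (is_graded_free_resolution I).

(* beta_(i,j)(R/I) = dim_k Tor_i(R/I, k)_j *)
Definition betti (k : fieldType) (n : nat) (I : {mpoly k[n]} -> Prop)
    (i : nat) (j : int) : nat :=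
  tens_homology_dim (chosen_resolution I) i j.

(* Unspecified when S has no greatest element. *)
Definition max_of (d : Order.disp_t) (T : orderType d) (x0 : T)
    (S : T -> Prop) : T :=
  epsilon (inhabits x0) (fun m => S m /\ forall x : T, S x -> (x <= m)%O).

Definition proj_dim (k : fieldType) (H : hypergraph) : nat :=
  max_of 0%N (fun i => exists j : int, betti (@edge_ideal k H) i j <> 0%N).

Definition reg (k : fieldType) (H : hypergraph) : int :=
  max_of 0 (fun r => exists (i : nat) (j : int),
    betti (@edge_ideal k H) i j <> 0%N /\ r = j - i%:Z).

(* Main.v *)
Require Import Defs.
From mathcomp Require Import all_boot all_order all_algebra.
From mathcomp Require Import mpoly.
From mathcomp Require Import ring zify.
From Stdlib Require Import ClassicalEpsilon.
Set Implicit Arguments.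
Unset Strict Implicit.
Unset Printing Implicit Defensive.
Import Order.TTheory GRing.Theory Num.Theory.
Local Open Scope ring_scope.

(** The Taylor resolution shows that, for a set [W] of vertices, the part of
    Tor_i(R/I_H, k) of squarefree multidegree [W] is the homology, at the sets
    of size [i], of the family of the sets of edges with union [W].  Let [W']
    consist of [W] and of the edges contained in [W].  Consider the
    independent sets (A, B) of the Levi graph induced on [W']: for fixed [B]
    the sets [A] range over all subsets of W minus the union of [B], an
    acyclic family unless that union is [W], so the independence complex has
    the homology of the covers [B] of [W].  Complementation identifies its
    cohomology with the homology of the vertex covers of the same graph, and
    fixing the other coordinate in a second bipartite incidence (edges of the
    Levi graph against [W']) turns vertex covers into edge covers, that is
    into Tor_p of the Levi graph in multidegree [W'], with p = |W'| - i.
    Hence the Levi graph has a nonzero Betti number with j - p = i. *)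

(** * Signed set families *)

(** Both invariants are maxima over nonvanishing Betti numbers, so only nonvanishing has to be
    carried across, never a dimension. Homology can therefore be witnessed by a cycle and a cocycle
    with nonzero pairing: no quotient spaces appear, and complementation merely exchanges the two
    witnesses. The changes between covers and independent sets keep set sizes; complementation alone
    replaces a size by its difference from the size of W', which is the origin of p. The remaining
    weight comes from [betti], which is computed from an arbitrarily chosen graded resolution:
    exactness of the Taylor complex and invariance under change of resolution both have to be
    proved. *)

Section SignedSets.
Variables (k : fieldType) (Z : finType).
Implicit Types (x y v : Z) (A B : {set Z}) (f g z phi : {set Z} -> k).

Definition precedes y x := (enum_rank y < enum_rank x)%N.

Definition sg x A : k := (-1) ^+ #|[set y in A | precedes y x]|.

(** Chains are functions on all subsets, the empty set included, graded by size: this is the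
    augmented simplicial boundary read coefficient by coefficient, and [cobd] is its transpose. *)
Definition bd f A : k := \sum_(x | x \notin A) sg x A * f (x |: A).

Definition cobd f A : k := \sum_(x in A) sg x A * f (A :\ x).

Lemma precedes_asym x y : x != y -> precedes x y = ~~ precedes y x.
Proof.
move=> xy. rewrite /precedes -leqNgt ltn_neqAle andb_idl // => _.
by apply: contra xy => /eqP e; apply/eqP/enum_rank_inj/val_inj.
Qed.

Lemma sg_sqr x A : sg x A * sg x A = 1.
Proof. by rewrite -expr2 sqrr_sign. Qed.

Lemma sgU x A B : [disjoint A & B] -> sg x (A :|: B) = sg x A * sg x B.
Proof.
move=> dAB; rewrite /sg -exprD -cardsUI.
have ->: [set y in A | precedes y x] :&: [set y in B | precedes y x] = set0.
  apply/setP=> y; rewrite !inE; case: (boolP (y \in A)) => //= yA.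
  by rewrite (disjointFr dAB yA) /= andbF.
rewrite cards0 addn0; congr (_ ^+ #|pred_of_set _|).
by apply/setP=> y; rewrite !inE andb_orl.
Qed.

Lemma sg_setU1 x y A : y \notin A -> sg x (y |: A) = (-1) ^+ precedes y x * sg x A.
Proof.
move=> yA; rewrite sgU ?disjoints1 //; congr (_ ^+ _ * _).
case: (boolP (precedes y x)) => [yx|/negbTE yx].
  rewrite (_ : [set _ in _ | _] = [set y]) ?cards1 //.
  by apply/setP=> t; rewrite !inE; case: eqVneq => // ->.
rewrite (_ : [set _ in _ | _] = set0) ?cards0 //.
by apply/setP=> t; rewrite !inE; case: eqVneq => // ->.
Qed.

Lemma sg_setU1id x A : sg x (x |: A) = sg x A.
Proof.
congr (_ ^+ #|pred_of_set _|); apply/setP=> t; rewrite !inE.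
by case: eqVneq => // ->; rewrite /precedes ltnn !andbF.
Qed.

Lemma sg_setD1id x A : sg x (A :\ x) = sg x A.
Proof.
case: (boolP (x \in A)) => xA; first by rewrite -sg_setU1id setD1K.
by congr sg; apply/setP=> t; rewrite !inE; case: eqVneq => // ->; rewrite (negbTE xA).
Qed.

Lemma sg_anticomm x y A : x != y -> x \notin A -> y \notin A ->
  sg x A * sg y (x |: A) = - (sg y A * sg x (y |: A)).
Proof.
move=> xy xA yA; rewrite !sg_setU1 // (precedes_asym xy).
by case: (precedes y x); rewrite !(expr0, expr1); ring.
Qed.

Lemma sg_anticomm_setU1 x y A : x != y -> x \notin A -> y \notin A ->
  sg x A * sg y A = - (sg y (x |: A) * sg x (y |: A)).
Proof.
move=> xy xA yA; rewrite !sg_setU1 // (precedes_asym xy).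
by case: (precedes y x); rewrite !(expr0, expr1); ring.
Qed.

Lemma eq_bd f g : f =1 g -> bd f =1 bd g.
Proof. by move=> e A; apply: eq_bigr => x _; rewrite e. Qed.

Lemma bdD f g A : bd (fun B => f B + g B) A = bd f A + bd g A.
Proof. by rewrite -big_split; apply: eq_bigr => x _; rewrite mulrDr. Qed.

Lemma cobdB f g A : cobd (fun B => f B - g B) A = cobd f A - cobd g A.
Proof. by rewrite -sumrB; apply: eq_bigr => x _; rewrite mulrBr. Qed.

(** Pairs are split by their order and one half is reindexed by the swap, since concluding from s =
    -s would fail in characteristic two. *)
Lemma antisym_sum0 (P : rel Z) (t : Z -> Z -> k) :
  (forall x y, P x y -> [/\ P y x, x != y & t x y = - t y x]) ->
  \sum_x \sum_(y | P x y) t x y = 0.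
Proof.
move=> H; rewrite pair_big_dep /= (bigID (fun u => precedes u.1 u.2)) /=.
rewrite addrC (reindex_inj (h := fun u : Z * Z => (u.2, u.1))) /=; last first.
  by move=> [a b] [c d] [-> ->].
rewrite (eq_bigl (fun u => P u.1 u.2 && precedes u.1 u.2)); last first.
  move=> [x y] /=; apply/andP/andP => -[/H [h xy _] p]; split=> //.
    by rewrite precedes_asym // eq_sym.
  by rewrite -precedes_asym // eq_sym.
rewrite -big_split big1 //= => -[x y] /andP [/H [_ _ ->] _] /=.
by rewrite subrr.
Qed.

Lemma bd_bd f A : bd (bd f) A = 0.
Proof.
rewrite /bd big_mkcond /=.
rewrite -[RHS](antisym_sum0 (P := fun x y => [&& x != y, x \notin A & y \notin A])
  (t := fun x y => sg x A * sg y (x |: A) * f (y |: (x |: A)))); last first.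
  move=> x y /and3P [xy xA yA]; rewrite eq_sym xy xA yA; split=> //.
  by rewrite sg_anticomm // mulNr setUCA.
apply: eq_bigr => x _; case: ifP => xA; last first.
  by rewrite big_pred0 // => y; rewrite andbF.
rewrite big_distrr /=; apply: eq_big => [y|y _]; last by rewrite mulrA.
by rewrite !inE negb_or eq_sym.
Qed.

Lemma bd_cobd_adj f g : \sum_A cobd f A * g A = \sum_A f A * bd g A.
Proof.
under eq_bigr do rewrite /cobd big_distrl /=.
under [RHS]eq_bigr do rewrite /bd big_distrr /=.
rewrite !pair_big_dep /=.
rewrite (reindex_onto (fun u : {set Z} * Z => (u.2 |: u.1, u.2))
   (fun u => (u.1 :\ u.2, u.2))) /=; last first.
  by move=> [A x] /= xA; rewrite setD1K.
apply: eq_big => [[A x]|[A x] /andP [_ /eqP [e]]] /=.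
  rewrite setU11 /= xpair_eqE eqxx andbT.
  apply/eqP/idP => [<-|xA]; first by rewrite !inE eqxx.
  by rewrite setU1K.
by rewrite e -sg_setD1id e mulrCA mulrA.
Qed.

Lemma cobd_cobd f A : cobd (cobd f) A = 0.
Proof.
pose e B : k := (B == A)%:R.
have E (h : {set Z} -> k) : \sum_B h B * e B = h A.
  rewrite (bigD1 A) //= /e eqxx mulr1 big1 ?addr0 // => B /negbTE ->.
  by rewrite mulr0.
rewrite -(E (cobd (cobd f))) !bd_cobd_adj big1 // => B _.
by rewrite bd_bd mulr0.
Qed.

End SignedSets.

(** * Peeling off acyclic subfamilies *)

Section Families.
Variables (k : fieldType) (Z : finType).
Implicit Types (x y v : Z) (A B C : {set Z}) (f g z phi : {set Z} -> k).
Implicit Types (P Q R u : pred {set Z}).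

Definition supported P i f := forall A, f A != 0 -> P A && (#|A| == i).

(* Nonzero homology, in size [i], of the complex spanned by a convex family
   [P]: a cycle [z] and a cocycle [phi] that detects it.  This form is
   self-dual. *)
Definition nonacyclic P i := exists z phi,
  [/\ supported P i z, supported P i phi,
      (forall A, P A -> bd z A = 0), (forall A, P A -> cobd phi A = 0)
    & \sum_A phi A * z A != 0].

Lemma nonacyclic_ext P Q i : P =1 Q -> nonacyclic P i -> nonacyclic Q i.
Proof.
move=> e [z [phi [sz sp bz cp n]]]; exists z, phi; split=> // A.
- by move/sz; rewrite e.
- by move/sp; rewrite e.
- by rewrite -e; apply: bz.
- by rewrite -e; apply: cp.
Qed.

(** Convex families span relative complexes: sets between two members are members, so the boundary
    cut down to the family squares to zero. *)
Definition convex P := forall A B C,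
  P A -> P C -> A \subset B -> B \subset C -> P B.

Section Peel.
Variables (P u : pred {set Z}) (v : Z) (i : nat).
Hypothesis cvxP : convex P.
Hypothesis up : forall A B, P A -> P B -> A \subset B -> u A -> u B.
Let N A := P A && ~~ u A.
Hypothesis toggle : forall A, v \notin A -> N A = N (v |: A).

Let toggleD A : v \in A -> N (A :\ v) = N A.
Proof. by move=> vA; rewrite toggle ?setD1K // !inE eqxx. Qed.

(** The sets in [N] are paired by toggling [v], so they span an acyclic subcomplex, with the sets
    satisfying [u] as quotient. A cycle [z] of the quotient has its boundary [c] in the subcomplex;
    coning [c] off at [v] gives [w] such that z + w is a cycle of [P]. As [w] lives on [N], its
    pairing with [phi] is zero. *)
Lemma nonacyclic_unpeel : nonacyclic (predI P u) i -> nonacyclic P i.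
Proof.
move=> [z [phi [sz sp bz cp n]]].
have bN A : ~~ N A -> bd z A != 0 -> P A -> False.
  rewrite /N => nN bn PA; move: nN; rewrite PA negbK => uA.
  by move: bn; rewrite bz ?eqxx //= PA uA.
pose c A := if N A then bd z A else 0.
pose w A := if v \in A then - sg k v (A :\ v) * c (A :\ v) else 0.
(* By convexity the sets between a member of [N] and a member of [P] stay in [P], so cutting [bd z]
   down to [N] loses no term of [bd (bd z)]. *)
have bc A : N A -> bd c A = 0.
  move=> NA; rewrite -[RHS](bd_bd z A); apply: eq_bigr => x xA.
  congr (_ * _); rewrite /c; case: ifP => // /negP nN.
  apply/eqP; rewrite eq_sym; apply/negPn/negP => bn.
  apply: (bN (x |: A)) => //; first by apply/negP.
  have [y /[!inE] /andP [_ yn]] : exists y, (y \notin x |: A) && (sg k y (x |: A) * z (y |: (x |: A)) != 0).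
    apply/existsP; move: bn; apply: contraR; rewrite negb_exists => /forallP h.
    by rewrite /bd big1 // => y yn; apply/eqP; move: (h y); rewrite yn negbK.
  have zn : z (y |: (x |: A)) != 0 by apply: contraNneq yn => ->; rewrite mulr0.
  case/andP: (sz _ zn) => /andP [Py _] _; case/andP: NA => PA _.
  by apply: (cvxP PA Py); apply: subsetU1.
have cn A : c A != 0 -> N A /\ #|A|.+1 = i.
  rewrite /c; case: ifP => [NA bn|_]; last by rewrite eqxx.
  split=> //; move: bn; apply: contraNeq => ne.
  rewrite /bd big1 // => x xA; case: (eqVneq (z (x |: A)) 0) => [->|].
    by rewrite mulr0.
  by case/sz/andP=> _; rewrite cardsU1 xA add1n (negbTE ne).
have wn A : w A != 0 -> N A /\ #|A| = i.
  rewrite /w; case: ifP => [vA bn|_]; last by rewrite eqxx.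
  have /cn [NA <-] : c (A :\ v) != 0.
    by apply: contraNneq bn => ->; rewrite mulr0.
  by rewrite -toggleD // (cardsD1 v A) vA.
have bw A : N A -> bd w A = - bd z A.
  move=> NA; case: (boolP (v \in A)) => vA; last first.
    rewrite /bd (bigD1 v) //= big1 ?addr0.
      rewrite /w setU11 setU1K // mulNr mulrN mulrA sg_sqr mul1r.
      by rewrite /c NA.
    move=> x /andP [xA xv]; rewrite /w !inE eq_sym (negbTE xv) (negbTE vA).
    by rewrite mulr0.
  have NA' : N (A :\ v) by rewrite toggleD.
  have vA' : v \notin A :\ v by rewrite !inE eqxx.
  have := bc _ NA'; rewrite {1}/bd (bigD1 v) //= setD1K // => /(canRL (addrK _)).
  rewrite sub0r => e.
  have -> : bd z A = c A by rewrite /c NA.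
  rewrite -[c A]mul1r -(sg_sqr k v (A :\ v)) -mulrA e mulrN opprK mulr_sumr.
  rewrite [LHS](eq_bigl (fun x => (x \notin A :\ v) && (x != v))); last first.
    by move=> x; rewrite !inE; case: eqVneq => [->|] //=; rewrite ?vA ?andbT.
  apply: eq_bigr => x /andP [xA' xv].
  have ->: w (x |: A) = - sg k v (x |: (A :\ v)) * c (x |: (A :\ v)).
    rewrite /w !inE vA orbT; congr (- sg _ _ _ * c _); apply/setP=> t;
    rewrite !inE; case: (eqVneq t v) => [->|] //=; by rewrite eq_sym (negbTE xv).
  have -> : sg k x A = sg k x (v |: (A :\ v)) by rewrite setD1K.
  rewrite mulNr mulrN !mulrA -mulNr; congr (_ * _).
  by rewrite [RHS]sg_anticomm_setU1 // eq_sym.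
exists (fun A => z A + w A), phi; split.
- move=> A; case: (eqVneq (w A) 0) => [->|/wn [/andP [-> _] ->] _]; last by rewrite eqxx.
  by rewrite addr0 => /sz /andP [/andP [-> _] ->].
- by move=> A /sp /andP [/andP [-> _] ->].
- move=> A PA; rewrite bdD; case: (boolP (u A)) => uA; last first.
    by rewrite bw ?subrr // /N PA.
  rewrite bz ?add0r /=; last by rewrite PA.
  rewrite /bd big1 // => x xA.
  case: (eqVneq (w (x |: A)) 0) => [->|/wn [/andP [Px /negP ux] _]].
    by rewrite mulr0.
  by case: ux; apply: (up PA Px) => //; apply: subsetU1.
- move=> A PA; case: (boolP (u A)) => uA; first by apply: cp; rewrite /= PA.
  rewrite /cobd big1 // => x xA.
  case: (eqVneq (phi (A :\ x)) 0) => [->|/sp /andP [/andP [Px ux] _]].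
    by rewrite mulr0.
  by case/negP: uA; apply: (up Px PA) => //; apply: subD1set.
- rewrite (eq_bigr (fun A => phi A * z A)) // => A _.
  case: (eqVneq (phi A) 0) => [->|/sp /andP [/andP [_ uA] _]].
    by rewrite !mul0r.
  case: (eqVneq (w A) 0) => [->|/wn [/andP [_ /negP //]]].
  by rewrite addr0.
Qed.

(** The dual correction: [z] restricted to [u] stays a cycle, but [phi] must vanish on [N] before it
    can be restricted. Subtracting the coboundary of [psi], which contracts [phi] on [N] along [v],
    achieves this; the pairing is unchanged because [bd z] vanishes on the support of [psi]. *)
Lemma nonacyclic_peel : nonacyclic P i -> nonacyclic (predI P u) i.
Proof.
move=> [z [phi [sz sp bz cp n]]].
pose psi A : k := if N A && (v \notin A) then sg k v A * phi (v |: A) else 0.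
have psin A : psi A != 0 -> N A /\ #|A|.+1 = i.
  rewrite /psi; case: ifP => [/andP [NA vA] bn|_]; last by rewrite eqxx.
  split=> //.
  have /sp /andP [_] : phi (v |: A) != 0.
    by apply: contraNneq bn => ->; rewrite mulr0.
  by rewrite cardsU1 vA => /eqP.
have cpsin A : cobd psi A != 0 -> exists x, x \in A /\ psi (A :\ x) != 0.
  move=> h; have /existsP [x /andP [xA hx]] :
    [exists x, (x \in A) && (psi (A :\ x) != 0)]; last by exists x.
  apply: contraR h; rewrite negb_exists => /forallP h.
  rewrite /cobd big1 // => x xA; move: (h x); rewrite xA negbK => /eqP ->.
  by rewrite mulr0.
have cpsi A : N A -> cobd psi A = phi A.
  move=> NA; case: (boolP (v \in A)) => vA.
    rewrite /cobd (bigD1 v) //= big1 ?addr0.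
      by rewrite /psi toggleD // NA !inE eqxx /= setD1K // mulrA sg_setD1id sg_sqr mul1r.
    move=> x /andP [xA xv]; rewrite /psi !inE vA eq_sym xv andbF.
    by rewrite mulr0.
  have NvA : N (v |: A) by rewrite -toggle.
  have: cobd phi (v |: A) = 0 by apply: cp; case/andP: NvA.
  rewrite /cobd (bigD1 v) ?setU11 //= setU1K // sg_setU1id.
  move/(canRL (addrK _)); rewrite sub0r => e.
  rewrite -[RHS]mul1r -(sg_sqr k v A) -mulrA e mulrN mulr_sumr -sumrN.
  rewrite [RHS](eq_bigl (fun x => x \in A)); last first.
    by move=> x; rewrite !inE; case: eqVneq => [->|] /=; rewrite ?andbT ?(negbTE vA).
  apply: eq_bigr => x xA.
  have xv : x != v by apply: contraNneq vA => <-.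
  have es : (v |: A) :\ x = v |: (A :\ x).
    by apply/setP=> t; rewrite !inE; case: (eqVneq t v) => [->|] //=; rewrite eq_sym xv.
  have vAx : v \notin A :\ x by rewrite !inE (negbTE vA) andbF.
  case: (eqVneq (phi ((v |: A) :\ x)) 0) => [e0|phn].
    by rewrite /psi -es e0 !mulr0 oppr0; case: ifP; rewrite ?mulr0.
  have Nx : N (A :\ x).
    rewrite toggle // -es; case/andP: (sp _ phn) => Px _.
    rewrite /N Px /=; case/andP: NvA => PvA; apply: contra.
    by apply: (up Px PvA); apply: subD1set.
  rewrite /psi Nx vAx /= -es !mulrA -mulNr; congr (_ * _).
  have xA' : x \notin A :\ x by rewrite !inE eqxx.
  rewrite -(sg_setD1id _ x A) sg_anticomm_setU1 // setD1K //.
  by rewrite -es sg_setD1id.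
have cpsin' A : cobd psi A != 0 -> exists2 B, N B & B \subset A /\ #|A| = i.
  move=> /cpsin [x [xA /psin [Nx <-]]]; exists (A :\ x) => //.
  by rewrite subD1set (cardsD1 x A) xA.
exists (fun A => if predI P u A then z A else 0).
exists (fun A => if predI P u A then phi A - cobd psi A else 0); split.
- by move=> A; case: ifP => [_ /sz /andP [_ ->] //|_]; rewrite eqxx.
- move=> A; case: ifP => [_ h|_]; last by rewrite eqxx.
  case: (eqVneq (phi A) 0) h => [->|/sp /andP [_ -> //]].
  by rewrite sub0r oppr_eq0 => /cpsin' [B _ [_ ->]]; rewrite eqxx.
- move=> A /andP [PA uA]; rewrite -[RHS](bz _ PA); apply: eq_bigr => x xA.
  case: ifP => // /negP h; case: (eqVneq (z (x |: A)) 0) => [-> //|].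
  move=> /sz /andP [Px _]; case: h; rewrite /= Px.
  by apply: (up PA Px) => //; apply: subsetU1.
- move=> A /andP [PA uA].
  transitivity (cobd (fun B => phi B - cobd psi B) A); last first.
    by rewrite cobdB cp // cobd_cobd subrr.
  apply: eq_bigr => x xA; case: ifP => //= /negP h; congr (_ * _).
  case: (boolP (P (A :\ x))) => Px.
    rewrite cpsi ?subrr // /N Px /=; apply/negP => ux; apply: h.
    by rewrite Px.
  case: (eqVneq (phi (A :\ x)) 0) => [->|/sp /andP []]; last by rewrite (negbTE Px).
  case: (eqVneq (cobd psi (A :\ x)) 0) => [->|]; first by rewrite subrr.
  move=> /cpsin' [B /andP [PB _] [BA _]]; case/negP: Px.
  by apply: (cvxP PB PA BA); apply: subD1set.
- rewrite (_ : \sum_A _ = \sum_A phi A * z A) //.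
  have: \sum_A cobd psi A * z A = 0.
    rewrite bd_cobd_adj big1 // => A _.
    case: (eqVneq (psi A) 0) => [->|/psin [/andP [PA _] _]]; first by rewrite mul0r.
    by rewrite bz // mulr0.
  move/(congr1 (fun t => \sum_A phi A * z A - t)); rewrite subr0 -sumrB => <-.
  apply: eq_bigr => A _; rewrite -mulrBl.
  case: ifP => //= h; case: (eqVneq (z A) 0) => [->|/sz /andP [PA _]].
    by rewrite !mulr0.
  by rewrite cpsi ?subrr ?mul0r // /N PA; move: h; rewrite PA /= => ->.
Qed.
End Peel.

(** * Independent sets and covers of a bipartite relation *)

Section Covers.
Variables (P Q : {set Z}) (r : rel Z).
Hypothesis dPQ : [disjoint P & Q].

Definition covered (x : Z) A := [exists y in A :&: Q, r x y].

Definition unrelated A :=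
  (A \subset P :|: Q) && [forall x in A :&: P, ~~ covered x A].

Definition covers A := (A \subset Q) && [forall x in P, covered x A].

Lemma covered_sub x A B : A \subset B -> covered x A -> covered x B.
Proof.
move=> sAB /exists_inP [y /setIP [yA yQ] xy]; apply/exists_inP; exists y => //.
by rewrite inE (subsetP sAB).
Qed.

Lemma convex_and (p q : pred {set Z}) :
  (forall A B, A \subset B -> p B -> p A) ->
  (forall A B, A \subset B -> q A -> q B) -> convex (predI p q).
Proof.
move=> hp hq A B C /andP [_ qA] /andP [pC _] AB BC.
by rewrite /= (hp _ C) // (hq A).
Qed.

Lemma unrelated_sub A B : A \subset B -> unrelated B -> unrelated A.
Proof.
move=> sAB /andP [sB /forallP h]; rewrite /unrelated (subset_trans sAB) //=.
apply/forallP => x; apply/implyP => /setIP [xA xP].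
have /(implyP (h x)) : x \in B :&: P by rewrite inE (subsetP sAB).
by apply: contra; apply: covered_sub.
Qed.

(** Interpolates between [unrelated], for the empty list, and [covers], for all of [P], so that one
    vertex is peeled off at a time. *)
Let part (s : seq Z) : pred {set Z} :=
  predI unrelated (fun A => all (fun x => covered x A) s).

Let cvx_part s : convex (part s).
Proof.
apply: convex_and unrelated_sub _ => A B sAB; apply: sub_all => x.
exact: covered_sub.
Qed.

(** An uncovered [v] has no neighbour in the set and, lying in [P], covers nothing itself, so
    toggling it affects neither independence nor coverage. *)
Let part_toggle s v : v \in P -> forall A, v \notin A ->
  part s A && ~~ covered v A = part s (v |: A) && ~~ covered v (v |: A).
Proof.
move=> vP A vA.
have e x : covered x (v |: A) = covered x A.
  apply: eq_existsb => y; rewrite !inE; case: eqVneq => // ->.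
  by rewrite (disjointFr dPQ vP) !andbF.
rewrite e /part /= (eq_all e); case: (boolP (covered v A)) => cv; rewrite ?andbF //.
suff -> : unrelated (v |: A) = unrelated A by [].
rewrite /unrelated subUset sub1set inE vP /=; congr andb.
apply: eq_forallb => x; rewrite !inE e; case: eqVneq => //= ->.
by rewrite cv !implybT.
Qed.

(** Once every vertex of [P] is covered, independence leaves no room for a vertex of [P]. *)
Let part_full : part (enum P) =1 covers.
Proof.
move=> A; have -> : part (enum P) A = unrelated A && [forall x in P, covered x A].
  congr (_ && _); apply/allP/forallP => h x; last by rewrite mem_enum; apply/implyP.
  by apply/implyP => xP; apply: h; rewrite mem_enum.
rewrite /covers; case: (boolP [forall _ in _, _]); rewrite ?andbF ?andbT //.
move=> /forallP h; apply/andP/idP => [[/subsetP sA /forallP nc]|sA]; last first.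
  split; first by apply: subset_trans sA _; apply: subsetUr.
  apply/forallP => x; apply/implyP => /setIP [/(subsetP sA) xQ xP].
  by rewrite (disjointFr dPQ xP) in xQ.
apply/subsetP => x xA; move: (sA x xA); rewrite inE => /orP [xP|//].
by move: (implyP (nc x)); rewrite inE xA xP (implyP (h x)) // => /(_ isT).
Qed.

Lemma nonacyclic_covers i : nonacyclic covers i <-> nonacyclic unrelated i.
Proof.
have e0 : part [::] =1 unrelated by move=> A; rewrite /part /= andbT.
have step s v : v \in P -> nonacyclic (part (v :: s)) i <-> nonacyclic (part s) i.
  move=> vP.
  have ee : predI (part s) (covered v) =1 part (v :: s).
    by move=> A; rewrite /part /= -andbA; congr (_ && _); rewrite andbC.
  split => [/(nonacyclic_ext (fsym ee))|h].
    apply: (@nonacyclic_unpeel _ _ v) => //; last exact: part_toggle.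
    by move=> A B _ _; apply: covered_sub.
  apply: (nonacyclic_ext ee); apply: (@nonacyclic_peel _ _ v) h => //; last exact: part_toggle.
  by move=> A B _ _; apply: covered_sub.
have all_steps s : {subset s <= P} -> nonacyclic (part s) i <-> nonacyclic unrelated i.
  elim: s => [_|v s IH sP]; first by split; apply: nonacyclic_ext => // A; rewrite e0.
  apply: iff_trans (step _ _ _) (IH _); first by apply: sP; rewrite mem_head.
  by move=> x xs; apply: sP; rewrite inE xs orbT.
apply: iff_trans (all_steps (enum P) _); last by move=> x; rewrite mem_enum.
by split; apply: nonacyclic_ext => A; rewrite part_full.
Qed.
End Covers.

Lemma unrelated_swap (P Q : {set Z}) (r : rel Z) :
  unrelated P Q r =1 unrelated Q P (fun x y => r y x).
Proof.
move=> A; rewrite /unrelated setUC; congr (_ && _); rewrite -[LHS]negbK -[RHS]negbK.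
rewrite !negb_forall; congr (~~ _); apply/existsP/existsP => -[x];
  rewrite negb_imply negbK => /andP [xA /existsP [y /andP [yA xy]]]; exists y;
  rewrite negb_imply negbK yA /=; apply/existsP; exists x; by rewrite xA.
Qed.

(** Combinatorial Alexander duality: complementation turns insertion into deletion, hence [bd] into
    [cobd]. Inserting [x] multiplies [eps] by [sg x W], which by [sgW] is exactly the discrepancy
    between the signs of [x] relative to [A] and to its complement. *)
Lemma nonacyclic_complement (W : {set Z}) P i :
  (forall A, P A -> A \subset W) -> nonacyclic P i ->
  nonacyclic (fun A => (A \subset W) && P (W :\: A)) (#|W| - i)%N.
Proof.
move=> sPW [z [phi [sz sp bz cp n]]].
pose eps A : k := \prod_(a in A) sg k a W.
pose dual f A : k := if A \subset W then eps A * f (W :\: A) else 0.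
have epsU x A : x \notin A -> eps (x |: A) = sg k x W * eps A.
  by move=> xA; rewrite /eps big_setU1.
have eps2 A : eps A * eps A = 1.
  by rewrite -big_split big1 //= => x _; rewrite sg_sqr.
have sgW x A : A \subset W -> sg k x (W :\: A) = sg k x A * sg k x W.
  move=> AW; rewrite -{2}(setID W A) (setIidPr AW) sgU ?mulrA ?sg_sqr ?mul1r //.
  by rewrite disjoint_sym disjoints_subset subsetDr.
have sdual f : supported P i f ->
    supported (fun A => (A \subset W) && P (W :\: A)) (#|W| - i)%N (dual f).
  move=> sf A; rewrite /dual; case: ifP => AW; last by rewrite eqxx.
  rewrite mulf_eq0 negb_or => /andP [_ /sf /andP [-> /eqP <-]] /=.
  by rewrite cardsDS // subKn // subset_leq_card.
exists (dual phi), (dual z); split; try exact: sdual.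
- move=> A /andP [AW PA]; rewrite -(mulr0 (eps A)) -(cp _ PA) mulr_sumr.
  rewrite /bd (bigID (fun x => x \in W)) /= addrC big1 ?add0r; last first.
    move=> x /andP [_ xW]; rewrite /dual subUset sub1set (negbTE xW) /=.
    by rewrite mulr0.
  apply: eq_big => [x|x /andP [xA xW]]; first by rewrite inE.
  rewrite /dual subUset sub1set xW AW /= epsU // sgW // !mulrA.
  congr (_ * phi _); last by rewrite setDDl setUC.
  by ring.
- move=> A /andP [AW PA]; rewrite -(mulr0 (eps A)) -(bz _ PA) mulr_sumr.
  rewrite [RHS](bigID (fun x => x \in W)) /= addrC [X in _ = X + _]big1 ?add0r; last first.
    move=> x /andP [_ xW]; case: (eqVneq (z (x |: W :\: A)) 0) => [->|].
      by rewrite !mulr0.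
    move=> /sz /andP [/sPW]; by rewrite subUset sub1set (negbTE xW).
  apply: eq_big => [x|x xA].
    rewrite inE negb_and negbK; case: (boolP (x \in A)) => /= [xA|_].
      by rewrite (subsetP AW).
    by case: (x \in W).
  have xW : x \in W by apply: (subsetP AW).
  have DW : A :\ x \subset W by apply: subset_trans (subD1set _ _) AW.
  have -> : eps A = sg k x W * eps (A :\ x).
    by rewrite -epsU ?setD1K // !inE eqxx.
  rewrite /dual DW sgW //.
  rewrite (_ : W :\: (A :\ x) = x |: W :\: A); last first.
    apply/setP=> t; rewrite !inE; case: (eqVneq t x) => [->|] //=.
  have s2 := sg_sqr k x W.
  have -> : sg k x W * eps (A :\ x) * (sg k x A * sg k x W * z (x |: W :\: A))
     = (sg k x W * sg k x W) * (sg k x A * (eps (A :\ x) * z (x |: W :\: A))) by ring.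
  by rewrite s2 mul1r.
- rewrite (_ : \sum_A _ = \sum_A phi A * z A) //.
  rewrite [RHS](bigID (fun A => A \subset W)) /= [X in _ = _ + X]big1 ?addr0; last first.
    move=> A nA; case: (eqVneq (z A) 0) => [->|]; first by rewrite mulr0.
    by move=> /sz /andP [/sPW]; rewrite (negbTE nA).
  rewrite [RHS](reindex_onto (fun A => W :\: A) (fun A => W :\: A)) /=; last first.
    by move=> A AW; rewrite setDDr setDv set0U; apply/setIidPr.
  rewrite big_mkcond [RHS]big_mkcond /=; apply: eq_bigr => A _.
  rewrite subsetDl /= setDDr setDv set0U /dual.
  case: (boolP (A \subset W)) => AW; last first.
    case: eqP => [e|]; last by rewrite mul0r.
    by case/negP: AW; rewrite -e subsetIl.
  rewrite (setIidPr AW) eqxx -{2}[phi _]mul1r -(eps2 A); ring.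
Qed.
End Families.

(** * From a hypergraph to its Levi graph *)

(** A nonzero pairing forces a nonempty support. This bounds the sizes that carry homology, and
    later the range of the Betti numbers. *)
Lemma nonacyclic_size (k : fieldType) (Z : finType) (P : pred {set Z}) i :
  nonacyclic k P i -> exists2 A, P A & #|A| = i.
Proof.
move=> [z [phi [sz _ _ _ n]]]; case: (pickP (fun A => z A != 0)) => [A|z0].
  by move/sz => /andP [PA /eqP e]; exists A.
case/eqP: n; rewrite big1 // => A _.
by move/negbFE/eqP: (z0 A) => ->; rewrite mulr0.
Qed.

(* The size [i] sets of this family index the basis, in multidegree [W], of
   the [i]-th module of the Taylor resolution of the ideal generated by the
   monomials with supports [m y], [y \in Q]. *)
Definition lcm_fiber (V Z : finType) (Q : {set Z}) (m : Z -> {set V})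
  (W : {set V}) : pred {set Z} :=
  fun B => (B \subset Q) && (\bigcup_(y in B) m y == W).

Section LeviBetti.
Variables (k : fieldType) (H : hypergraph).

(* Vertices of H, edges of H and edges of the Levi graph in a single ordered
   type, so that signs never have to be transported. *)
Definition incidence : finType :=
  (levi_vertex H + hvertex H * {F : {set hvertex H} | F \in hedges H})%type.

Definition hedge_index : {set incidence} :=
  [set t : incidence | if t is inl (inr _) then true else false].
Definition hedge_support (t : incidence) : {set hvertex H} :=
  if t is inl (inr F) then val F else set0.
Definition levi_edge_index : {set incidence} :=
  [set t : incidence | if t is inr (x, F) then x \in val F else false].
Definition levi_edge_support (t : incidence) : {set levi_vertex H} :=
  if t is inr (x, F) then [set inl x; inr F] else set0.

Variable W : {set hvertex H}.

Definition induced_levi : {set levi_vertex H} :=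
  [set v : levi_vertex H | match v with inl x => x \in W | inr F => val F \subset W end].

Let vW : {set incidence} := [set t : incidence | if t is inl (inl x) then x \in W else false].
Let eW : {set incidence} :=
  [set t : incidence | if t is inl (inr F) then val F \subset W else false].
Let lW : {set incidence} :=
  [set t : incidence | if t is inr (x, F) then (x \in val F) && (val F \subset W) else false].
Let veW : {set incidence} := [set t : incidence | if t is inl v then v \in induced_levi else false].
Let r1 : rel incidence := fun a b =>
  match a, b with inl (inl x), inl (inr F) => x \in val F | _, _ => false end.
(** Joins an edge of the Levi graph to its two ends: covers of edges by vertices are vertex covers,
    and covers for the converse relation are edge covers. *)
Let r2 : rel incidence := fun a b =>
  match a, b with
  | inr (x, F), inl (inl x') => x' == x
  | inr (x, F), inl (inr F') => F' == F
  | _, _ => false end.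

Let veWE : veW = vW :|: eW.
Proof. by apply/setP=> -[[x|F]|[x F]]; rewrite !inE ?orbF. Qed.

Let covers_hedges : lcm_fiber hedge_index hedge_support W =1 covers vW eW r1.
Proof.
move=> B; apply/andP/andP => -[/subsetP sB h].
  split.
    apply/subsetP => t tB; move: (sB t tB).
    case: t tB => [[x|F]|[x F]]; rewrite !inE // => tB _.
    by rewrite -(eqP h); apply: (bigcup_sup (inl (inr F))).
  apply/forall_inP => -[[x|F]|[x F]]; rewrite !inE // -(eqP h).
  move=> /bigcupP [[[y|F]|[y F]]] //= tB; rewrite ?inE // => xF.
  apply/exists_inP; exists (inl (inr F)) => //; rewrite !inE tB.
  by rewrite -(eqP h); apply: (bigcup_sup (inl (inr F))).
split.
  apply/subsetP => t tB; move: (sB t tB).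
  by case: t tB => [[x|F]|[x F]]; rewrite !inE.
rewrite eqEsubset; apply/andP; split.
  apply/bigcupsP => t /sB; case: t => [[x|F]|[x F]]; rewrite !inE //.
apply/subsetP => x xW; apply/bigcupP.
have /(forall_inP h) /exists_inP [[[y|F]|[y F]]] //= : inl (inl x) \in vW by rewrite inE.
by rewrite inE => /andP [tB _] xF; exists (inl (inr F)).
Qed.

(** A set is independent exactly when its complement meets every edge. For [lW] it suffices to ask
    that the hyperedge lie inside [W], as its vertices then do too. *)
Let covers_complement :
  (fun A : {set incidence} => (A \subset vW :|: eW) && unrelated vW eW r1 ((vW :|: eW) :\: A))
  =1 covers lW veW r2.
Proof.
move=> A; rewrite -veWE; congr andb; rewrite /unrelated -veWE subsetDl /=.
apply/forall_inP/forall_inP => h.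
  move=> [[x|F]|[x F]]; rewrite !inE // => /andP [xF FW].
  have xW : x \in W by apply: (subsetP FW).
  case: (boolP (inl (inl x) \in A)) => [xA|xA].
    by apply/exists_inP; exists (inl (inl x)) => /=; rewrite ?eqxx ?inE ?xA ?xW.
  case: (boolP (inl (inr F) \in A)) => [FA|FA].
    by apply/exists_inP; exists (inl (inr F)) => /=; rewrite ?eqxx ?inE ?FA ?FW.
  have /h /exists_inP [] : inl (inl x) \in (veW :\: A) :&: vW by rewrite !inE xA xW.
  by exists (inl (inr F)) => //; rewrite !inE FA FW.
move=> [[x|F]|[x F]]; rewrite !inE ?andbF // => /andP [/andP [xA xW] _].
apply/exists_inP => -[[[y|F]|[y F]]] //=; rewrite !inE => /andP [/andP [FA FW] _] xF.
have /h /exists_inP [[[y|F']|[y F']]] //= : inr (x, F) \in lW by rewrite !inE xF FW.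
  by rewrite inE => /andP [yA _] /eqP e; rewrite -e yA in xA.
by rewrite inE => /andP [yA _] /eqP e; rewrite -e yA in FA.
Qed.

Let covers_levi :
  covers veW lW (fun x y => r2 y x) =1
  lcm_fiber levi_edge_index levi_edge_support induced_levi.
Proof.
move=> B; apply/andP/andP => -[/subsetP sB h].
  split.
    apply/subsetP => t tB; move: (sB t tB).
    by case: t tB => [[x|F]|[x F]]; rewrite !inE // => _ /andP [].
  rewrite eqEsubset; apply/andP; split.
    apply/bigcupsP => t /sB; case: t => [[x|F]|[x F]]; rewrite !inE //= => /andP [xF FW].
    by rewrite subUset !sub1set !inE FW (subsetP FW).
  apply/subsetP => v vI; apply/bigcupP.
  have /(forall_inP h) /exists_inP [[[y|F]|[y F]]] : inl v \in veW by rewrite inE.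
  - by case: v {vI}.
  - by case: v {vI}.
  rewrite inE => /andP [tB _] e; exists (inr (y, F)) => //=.
  by case: v e {vI} => [x|E] /eqP ->; rewrite !inE eqxx ?orbT.
(* The union is [induced_levi], so the hyperedge end of each chosen Levi edge belongs to it, that
   is, lies inside [W]. *)
have FW t : t \in B -> t \in lW.
  move=> tB; move: (sB _ tB); case: t tB => [[x|F]|[x F]]; rewrite !inE // => tB ->.
  have : inr F \in induced_levi.
    rewrite -(eqP h); apply/bigcupP; exists (inr (x, F)) => //=.
    by rewrite !inE eqxx.
  by rewrite inE.
split; first by apply/subsetP => t /FW.
apply/forall_inP => -[v|t]; rewrite inE // -(eqP h) => /bigcupP [t tB vt].
apply/exists_inP; exists t; first by rewrite inE tB FW.
by case: t tB vt => [[x|F]|[x F]]; rewrite ?inE //; case: v => [y|E] /=; rewrite ?(inE, orbF).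
Qed.

Lemma nonacyclic_levi i :
  nonacyclic k (lcm_fiber hedge_index hedge_support W) i ->
  exists p, (p + i)%N = #|induced_levi| /\
    nonacyclic k (lcm_fiber levi_edge_index levi_edge_support induced_levi) p.
Proof.
have d1 : [disjoint vW & eW].
  by rewrite disjoints_subset; apply/subsetP => -[[x|F]|[x F]]; rewrite !inE.
have d2 : [disjoint lW & veW].
  by rewrite disjoints_subset; apply/subsetP => -[[x|F]|[x F]]; rewrite !inE.
move/(nonacyclic_ext covers_hedges)/(nonacyclic_covers k r1 d1 i) => n.
(* A member of size [i] shows that [i] is at most the size of [induced_levi], which makes the
   truncated subtraction below exact. *)
have [A /andP [sA _] iA] := nonacyclic_size n.
have eW' : #|vW :|: eW| = #|induced_levi|.
  have inj : injective (inl : levi_vertex H -> incidence) by move=> a b [].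
  rewrite -veWE -(card_imset (mem induced_levi) inj).
  apply: eq_card => t; rewrite inE; apply/idP/imsetP => [|[v vI ->//]].
  by case: t => // v vI; exists v.
exists (#|induced_levi| - i)%N; split.
  by rewrite subnK // -eW' -iA subset_leq_card.
(* Read from the goal backwards: edge covers come from sets independent in the incidence of Levi
   edges with Levi vertices, these from vertex covers, and those by complementation from [n]. *)
apply: (nonacyclic_ext covers_levi); rewrite disjoint_sym in d2.
apply/(nonacyclic_covers k _ d2); rewrite disjoint_sym in d2.
apply: (nonacyclic_ext (unrelated_swap _ _ _)); apply/(nonacyclic_covers k _ d2).
apply: (nonacyclic_ext covers_complement); rewrite -eW'.
by apply: nonacyclic_complement => // B /andP [].
Qed.
End LeviBetti.

(** * The Taylor resolution *)

Section SquarefreeMonomials.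
Variables (V : finType).
Implicit Types (A B W : {set V}).

Definition set_mnm W : 'X_{1..#|V|} := (\sum_(x in W) U_(enum_rank x))%MM.

Lemma set_mnmE W i : set_mnm W i = (enum_val i \in W).
Proof.
rewrite mnm_sumE; case: (boolP (_ \in W)) => iW.
  rewrite (bigD1 (enum_val i)) //= mnm1E enum_valK eqxx big1 // => x /andP [_ xi].
  rewrite mnm1E; case: eqP => // e; case/eqP: xi.
  by rewrite -e enum_rankK.
rewrite big1 // => x xW; rewrite mnm1E; case: eqP => // e.
by rewrite -e enum_rankK xW in iW.
Qed.

Lemma mdeg_set_mnm W : mdeg (set_mnm W) = #|W|.
Proof. by rewrite mdeg_sum -[RHS]sum1_card; apply: eq_bigr => x _; rewrite mdeg1. Qed.

Lemma edge_monomialE (k : fieldType) W : edge_monomial k W = 'X_[set_mnm W].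
Proof. by rewrite /set_mnm (big_morph _ (@mpolyXD _ _) (@mpolyX0 _ _)). Qed.

Lemma set_mnm_addD A B : A \subset B ->
  (set_mnm A + set_mnm (B :\: A))%MM = set_mnm B.
Proof.
move=> AB; apply/mnmP => i; rewrite mnmDE !set_mnmE inE.
by case: (boolP (_ \in A)) => // /(subsetP AB) ->.
Qed.

Lemma set_mnm_sub A B : A \subset B -> (set_mnm A <= set_mnm B)%MM.
Proof. by move=> AB; rewrite -(set_mnm_addD AB) lem_addr. Qed.

Lemma set_mnm_bigcup (I : finType) (m : I -> {set V}) (J : {set I}) M :
  (forall y, y \in J -> (set_mnm (m y) <= M)%MM) ->
  (set_mnm (\bigcup_(y in J) m y) <= M)%MM.
Proof.
move=> h; apply/mnm_lepP => i; rewrite set_mnmE.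
case: (boolP (_ \in _)) => // /bigcupP [y yJ iy].
by have /mnm_lepP /(_ i) := h y yJ; rewrite set_mnmE iy.
Qed.
End SquarefreeMonomials.

Lemma mcoeffXM (k : fieldType) n (e M : 'X_{1..n}) (p : {mpoly k[n]}) :
  ('X_[e] * p)@_M = if (e <= M)%MM then p@_(M - e) else 0.
Proof.
case: ifP => [eM|/negP eM].
  by rewrite -{1}(submK eM) addmC mulrC mcoeffMX.
apply: memN_msupp_eq0; rewrite mulrC (perm_mem (msuppMX _ _)).
by apply/negP => /mapP [t _ e']; apply: eM; rewrite e' lem_addr.
Qed.

Section FaceMatrices.
Variables (Z : finType) (Q : {set Z}).

Definition faces (i : nat) : {set {set Z}} := [set B : {set Z} | (B \subset Q) && (#|B| == i)].

Definition face i (c : 'I_#|faces i|) : {set Z} := enum_val c.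

Variable S : comNzRingType.

(** Row vectors are traded for functions on all subsets that vanish off [faces i]; the sum yields
    this zero without a membership proof. *)
Definition face_coord i (u : 'rV[S]_#|faces i|) (B : {set Z}) : S :=
  \sum_(c | face c == B) u 0 c.

Definition face_row i (f : {set Z} -> S) : 'rV[S]_#|faces i| :=
  \row_c f (face c).

(** At most one [y] fits, so the sum is the coefficient for deleting [y], or zero if [face c] is not
    obtained by deleting one element. *)
Definition face_mx (t : Z -> {set Z} -> S) i : 'M[S]_(#|faces i.+1|, #|faces i|) :=
  \matrix_(r, c) \sum_(y in face r | face c == face r :\ y) t y (face c).

Definition face_map (t : Z -> {set Z} -> S) (f : {set Z} -> S) (A : {set Z}) : S :=
  \sum_(y | y \notin A) t y A * f (y |: A).

Lemma face_coordE i (u : 'rV[S]_#|faces i|) c : face_coord u (face c) = u 0 c.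
Proof.
rewrite /face_coord (big_pred1 c) // => d.
by rewrite (inj_eq enum_val_inj).
Qed.

Lemma face_coord_notin i (u : 'rV[S]_#|faces i|) B : B \notin faces i -> face_coord u B = 0.
Proof.
move=> nB; rewrite /face_coord big_pred0 // => c.
by apply: contraNF nB => /eqP <-; apply: enum_valP.
Qed.

Lemma face_coord0 i B : face_coord (0 : 'rV[S]_#|faces i|) B = 0.
Proof. by rewrite /face_coord big1 // => c _; rewrite mxE. Qed.

Lemma face_rowK i (f : {set Z} -> S) : (forall B, B \notin faces i -> f B = 0) ->
  face_coord (face_row i f) =1 f.
Proof.
move=> f0 B; case: (boolP (B \in faces i)) => Bi; last first.
  by rewrite face_coord_notin ?f0.
by rewrite -(enum_rankK_in Bi Bi) -/(face _) face_coordE mxE.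
Qed.

Lemma face_rowP i (u v : 'rV[S]_#|faces i|) : face_coord u =1 face_coord v -> u = v.
Proof. by move=> e; apply/rowP => c; rewrite -!face_coordE e. Qed.

Lemma faces_setU1 (y : Z) (A : {set Z}) i : y \notin A -> y |: A \in faces i.+1 -> A \in faces i.
Proof.
move=> yA; rewrite !inE cardsU1 yA add1n eqSS => /andP [].
by rewrite subUset => /andP [_ ->].
Qed.

Lemma face_coord_mul t i (u : 'rV[S]_#|faces i.+1|) :
  face_coord (u *m face_mx t i) =1 face_map t (face_coord u).
Proof.
move=> A; case: (boolP (A \in faces i)) => Ai; last first.
  rewrite face_coord_notin // /face_map big1 // => y yA.
  rewrite face_coord_notin ?mulr0 //; apply: contra Ai.
  exact: faces_setU1.
rewrite -(enum_rankK_in Ai Ai) -/(face _) face_coordE mxE; set c := enum_rank_in _ _.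
transitivity (\sum_(B in faces i.+1) \sum_(y in B | face c == B :\ y)
   t y (face c) * face_coord u B).
  rewrite [RHS]big_enum_val; apply: eq_bigr => r _; rewrite mxE -/(face r) face_coordE mulrC big_distrl.
  by apply: eq_bigr.
rewrite (exchange_big_dep (fun y => y \notin face c)) /=; last first.
  by move=> B y _ /andP [_ /eqP ->]; rewrite !inE eqxx.
apply: eq_bigr => y yA; rewrite -mulr_sumr; congr (_ * _).
case: (boolP (y |: face c \in faces i.+1)) => yi; last first.
  rewrite face_coord_notin // big1 // => B /andP [Bi /andP [yB /eqP e]].
  by case/negP: yi; rewrite e setD1K.
rewrite (big_pred1 (y |: face c)) // => B; apply/idP/eqP => [|->].
  by move=> /andP [_ /andP [yB /eqP ->]]; rewrite setD1K.
by rewrite yi setU11 setU1K //= eqxx.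
Qed.
End FaceMatrices.

Section Cone.
Variables (k : fieldType) (Z : finType).

Definition cone (y : Z) (c : {set Z} -> k) (A : {set Z}) : k :=
  if y \in A then sg k y (A :\ y) * c (A :\ y) else 0.

(** Contractibility of the full simplex. At sets avoiding [y] the cone restores [c] directly; at
    sets containing [y] the value of [c] is recovered from the cycle condition at [A :\ y]. *)
Lemma bd_cone y c A : (forall B, bd c B = 0) -> bd (cone y c) A = c A.
Proof.
move=> bc; case: (boolP (y \in A)) => yA; last first.
  rewrite /bd (bigD1 y) //= big1 ?addr0.
    by rewrite /cone setU11 setU1K // mulrA sg_sqr mul1r.
  by move=> x /andP [xA xy]; rewrite /cone !inE eq_sym (negbTE xy) (negbTE yA) mulr0.
have yA' : y \notin A :\ y by rewrite !inE eqxx.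
have := bc (A :\ y); rewrite {1}/bd (bigD1 y) //= setD1K // => /(canRL (addrK _)).
rewrite sub0r => e.
rewrite -[RHS]mul1r -(sg_sqr k y (A :\ y)) -mulrA e mulrN mulr_sumr -sumrN.
rewrite [LHS](eq_bigl (fun x => (x \notin A :\ y) && (x != y))); last first.
  by move=> x; rewrite !inE; case: eqVneq => [->|] //=; rewrite ?yA ?andbT.
apply: eq_bigr => x /andP [xA' xy].
have ->: cone y c (x |: A) = sg k y (x |: (A :\ y)) * c (x |: (A :\ y)).
  rewrite /cone !inE yA orbT.
  have -> : (x |: A) :\ y = x |: A :\ y by
    apply/setP=> t; rewrite !inE; case: (eqVneq t y) => [->|] //=; rewrite eq_sym (negbTE xy).
  by [].
have -> : sg k x A = sg k x (y |: (A :\ y)) by rewrite setD1K.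
rewrite !mulrA -mulNr; congr (_ * _).
by rewrite [in RHS]sg_anticomm_setU1 ?opprK // eq_sym.
Qed.
End Cone.

Section Taylor.
Variables (k : fieldType) (V Z : finType) (Q : {set Z}) (m : Z -> {set V}).
Implicit Types (A B : {set Z}) (M : 'X_{1..#|V|}).
Local Notation R := {mpoly k[#|V|]}.

Definition lcm_set B : {set V} := \bigcup_(y in B) m y.

Lemma lcm_setS A B : A \subset B -> lcm_set A \subset lcm_set B.
Proof.
by move=> AB; apply/bigcupsP => y yA; apply: bigcup_sup; apply: (subsetP AB).
Qed.

Definition taylor_coef y A : R :=
  sg k y A *: 'X_[set_mnm (lcm_set (y |: A) :\: lcm_set A)].

Definition taylor : free_seq k #|V| :=
  @FreeSeq k #|V| (fun i => #|faces Q i|)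
    (fun i c => #|lcm_set (face c)|%:Z)
    (fun i => face_mx Q taylor_coef i) (const_mx 1).

(** The basis element at [A] has as multidegree the monomial of [lcm_set A], so these scalars form
    the component of [f] in multidegree [M]. *)
Definition multideg_part M (f : {set Z} -> R) A : k :=
  if (set_mnm (lcm_set A) <= M)%MM then (f A)@_(M - set_mnm (lcm_set A)) else 0.

(** Quotients of successive lcms telescope, so in a fixed multidegree only the signs of the Taylor
    map remain. *)
Lemma multideg_part_map M f A :
  multideg_part M (face_map taylor_coef f) A = bd (multideg_part M f) A.
Proof.
have key y : y \notin A ->
    (set_mnm (lcm_set A) + set_mnm (lcm_set (y |: A) :\: lcm_set A)
     = set_mnm (lcm_set (y |: A)))%MM.
  by move=> _; apply/set_mnm_addD/lcm_setS/subsetU1.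
rewrite /multideg_part; case: ifP => [AM|/negP AM].
  rewrite raddf_sum; apply: eq_bigr => y yA.
  rewrite /= -scalerAl mcoeffZ mcoeffXM submDA key //; congr (_ * _).
  rewrite (_ : (_ <= M - _)%MM = (set_mnm (lcm_set (y |: A)) <= M)%MM) //.
  rewrite -(key y yA); apply/mnm_lepP/mnm_lepP => h j; move: (h j) (mnm_lepP AM j).
    by rewrite !(mnmDE, mnmBE); lia.
  by rewrite !(mnmDE, mnmBE); lia.
rewrite /bd big1 // => y yA; case: ifP; rewrite ?mulr0 // => yAM; case: AM.
by apply: lepm_trans yAM; apply/set_mnm_sub/lcm_setS/subsetU1.
Qed.

Lemma multideg_part_inj f g :
  (forall M, multideg_part M f =1 multideg_part M g) -> f =1 g.
Proof.
move=> h A; apply/mpolyP => N.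
have := h (N + set_mnm (lcm_set A))%MM A.
by rewrite /multideg_part lem_addl addmK.
Qed.

Lemma taylor_map2 f A : face_map taylor_coef (face_map taylor_coef f) A = 0.
Proof.
apply: (multideg_part_inj (f := face_map _ (face_map _ f)) (g := fun=> 0)) => M B.
rewrite multideg_part_map (eq_bd (multideg_part_map M f)) bd_bd.
by rewrite /multideg_part mcoeff0 if_same.
Qed.

(* In multidegree M the Taylor complex is the full simplex on the generators
   dividing 'X_[M], so coning off one of them lifts cycles. *)
Definition multideg_lift f M : {set Z} -> k :=
  if [pick y in Q | (set_mnm (m y) <= M)%MM] is Some y
  then cone y (multideg_part M f) else fun=> 0.

Lemma multideg_liftP i f M : (forall B, B \notin faces Q i.+1 -> f B = 0) ->
  (forall A, face_map taylor_coef f A = 0) ->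
  (bd (multideg_lift f M) =1 multideg_part M f) /\
  (forall B, multideg_lift f M B != 0 ->
    B \in faces Q i.+2 /\ (set_mnm (lcm_set B) <= M)%MM).
Proof.
move=> sf df; rewrite /multideg_lift.
have supp A : multideg_part M f A != 0 ->
    A \in faces Q i.+1 /\ (set_mnm (lcm_set A) <= M)%MM.
  rewrite /multideg_part; case: ifP => [AM h|]; last by rewrite eqxx.
  split=> //; apply: contraNT h => /sf ->; by rewrite mcoeff0.
case: pickP => [y /andP [yQ yM]|none].
  split=> [A|B].
    apply: bd_cone => B; rewrite -multideg_part_map /multideg_part df mcoeff0.
    by rewrite if_same.
  rewrite /cone; case: ifP => [yB|]; last by rewrite eqxx.
  rewrite mulf_eq0 negb_or => /andP [_ /supp [Bi BM]]; split.
    move: Bi; rewrite !inE (cardsD1 y B) yB add1n eqSS => /andP [BQ ->].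
    by rewrite -(setD1K yB) subUset sub1set yQ BQ.
  apply: set_mnm_bigcup => t tB; case: (eqVneq t y) => [->//|ty].
  apply: lepm_trans BM; apply: set_mnm_sub; apply: bigcup_sup.
  by rewrite !inE ty.
split=> [A|B]; last by rewrite eqxx.
rewrite /bd big1 => [|y _]; last by rewrite mulr0.
apply/esym/eqP; apply: contraT => /supp [].
rewrite inE => /andP [AQ /eqP cA] AM.
(* Sizes start at one: a nonempty [A] has an element, whose monomial divides the lcm and hence
   'X_[M], against [none]. *)
have /card_gt0P [y yA] : (0 < #|A|)%N by rewrite cA.
move: (none y); rewrite (subsetP AQ) //= => /negP [].
by apply: lepm_trans AM; apply: set_mnm_sub; apply: bigcup_sup.
Qed.

Lemma taylor_exact i f : (forall B, B \notin faces Q i.+1 -> f B = 0) ->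
  (forall A, face_map taylor_coef f A = 0) ->
  exists2 g, (forall B, B \notin faces Q i.+2 -> g B = 0) &
    face_map taylor_coef g =1 f.
Proof.
move=> sf df.
pose w := multideg_lift f.
have wP M := multideg_liftP M sf df.
(* The finitely many multidegrees occurring in [f]; [undup] makes each count once in the sum [g] of
   the lifts. *)
pose S := undup (flatten [seq [seq (set_mnm (lcm_set A) + t)%MM | t <- msupp (f A)]
                         | A <- enum {set Z}]).
have w0 M B : M \notin S -> w M B = 0.
  move=> MS; have c0 A : multideg_part M f A = 0.
    rewrite /multideg_part; case: ifP => // AM; apply: memN_msupp_eq0.
    apply: contra MS => h; rewrite mem_undup; apply/flattenP.
    exists [seq (set_mnm (lcm_set A) + t)%MM | t <- msupp (f A)].
      by apply/mapP; exists A; rewrite ?mem_enum.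
    by apply/mapP; exists (M - set_mnm (lcm_set A))%MM; rewrite // addmC submK.
  rewrite /w /multideg_lift; case: pickP => // y _.
  by rewrite /cone c0 mulr0 if_same.
pose g B : R := \sum_(M <- S) w M B *: 'X_[M - set_mnm (lcm_set B)].
exists g => [B Bi|].
  rewrite /g big1 // => M _; case: (eqVneq (w M B) 0) => [->|]; first by rewrite scale0r.
  by case/(proj2 (wP M)); rewrite (negbTE Bi).
have part_g M B : multideg_part M g B = w M B.
  rewrite /multideg_part; case: ifP => [BM|/negP BM]; last first.
    by apply/esym/eqP; apply: contraT => /(proj2 (wP M)) [_ /BM].
  rewrite raddf_sum /=.
  have term N : (w N B *: 'X_[N - set_mnm (lcm_set B)])@_(M - set_mnm (lcm_set B))
      = if N == M then w M B else 0.
    rewrite mcoeffZ mcoeffX; case: (eqVneq N M) => [->|NM]; first by rewrite eqxx mulr1.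
    case: (eqVneq (w N B) 0) => [->|]; first by rewrite mul0r.
    case/(proj2 (wP N)) => _ BN; case: eqP => [e|]; last by rewrite mulr0.
    by case/eqP: NM; rewrite -(submK BN) e submK.
  rewrite (eq_bigr _ (fun N _ => term N)) -big_mkcond.
  case: (boolP (M \in S)) => MS.
    by rewrite (big_rem M) //= eqxx big1_seq ?addr0 // => N /andP [/eqP ->];
       rewrite mem_rem_uniq ?undup_uniq // inE eqxx.
  by rewrite w0 // big1_seq // => N /andP [/eqP ->]; rewrite (negbTE MS).
apply: multideg_part_inj => M A.
by rewrite multideg_part_map (eq_bd (part_g M)) (proj1 (wP M)).
Qed.

Variable I : R -> Prop.
Hypothesis I_gen : forall p, I p <->
  exists c : Z -> R, p = \sum_(y in Q) c y * 'X_[set_mnm (m y)].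

Lemma taylor_is_resolution : is_graded_free_resolution I taylor.
Proof.
have f0 (c : 'I_#|faces Q 0|) : face c = set0.
  by have := enum_valP c; rewrite inE => /andP [_]; rewrite cards_eq0 => /eqP.
have in0 : set0 \in faces Q 0 by rewrite inE sub0set cards0 eqxx.
have aug0 (u : 'rV_#|faces Q 0|) : (u *m const_mx 1 : 'M_(1,1)) 0 0 = face_coord u set0.
  rewrite mxE /face_coord; apply: eq_big => [c|c _]; first by rewrite f0 eqxx.
  by rewrite mxE mulr1.
have I0 : I 0 by apply/I_gen; exists (fun=> 0); rewrite big1 // => y _; rewrite mul0r.
split=> /=.
- move=> c M; rewrite mxE msupp1 inE => /eqP ->.
  by rewrite mdeg0 f0 /lcm_set big_set0 cards0.
- move=> i r c M; rewrite mxE mcoeff_msupp => h.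
  have /existsP [y /andP [/andP [yr /eqP e] cy]] : [exists y, (y \in face r) &&
      (face c == face r :\ y) && ((taylor_coef y (face c))@_M != 0)].
    apply: contraR h; rewrite negb_exists => /forallP h.
    rewrite raddf_sum big1 //= => y yr; move: (h y); rewrite yr /= negbK.
    by move/eqP.
  move: cy; rewrite mcoeffZ mcoeffX; case: (set_mnm _ =P M) => [<- _|]; last by rewrite mulr0 eqxx.
  rewrite mdeg_set_mnm e setD1K // cardsDS ?lcm_setS ?subD1set //.
  by rewrite subzn // subset_leq_card // lcm_setS // subD1set.
- move=> p; exists (face_row Q 0 (fun B => if B == set0 then p else 0)).
  rewrite aug0 face_rowK ?eqxx ?subrr // => B B0; case: eqP => // e.
  by rewrite e in0 in B0.
- move=> u; rewrite aug0.
  (* The first Taylor map sends the basis element of a singleton to its generator, so its image is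
     the ideal. *)
  have map0 (f : {set Z} -> R) : (forall B, B \notin faces Q 1 -> f B = 0) ->
      face_map taylor_coef f set0 = \sum_(y in Q) f [set y] * 'X_[set_mnm (m y)].
    move=> sf; rewrite [RHS]big_mkcond /face_map [LHS](eq_bigl predT); last by move=> y; rewrite inE.
    apply: eq_bigr => y _; case: ifP => yQ; last first.
      by rewrite setU0 sf ?mulr0 // !inE sub1set yQ.
    rewrite /taylor_coef setU0 /lcm_set big_set0 setD0 big_set1 mulrC; congr (_ * _).
    rewrite /sg (_ : [set _ in _ | _] = set0) ?cards0 ?scale1r //.
    by apply/setP => t; rewrite !inE.
  split=> [/I_gen [c e]|[v ->]].
    pose f B := if [pick y | B == [set y] ] is Some y then
                  (if y \in Q then c y else 0) else 0.
    have fE y : y \in Q -> f [set y] = c y.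
      move=> yQ; rewrite /f; case: pickP => [x /eqP /set1_inj <-|/(_ y)]; last by rewrite eqxx.
      by rewrite yQ.
    have sf B : B \notin faces Q 1 -> f B = 0.
      rewrite /f; case: pickP => // x /eqP -> {B}; rewrite inE cards1 sub1set.
      by case: ifP.
    exists (face_row Q 1 f); apply: face_rowP => A.
    rewrite face_coord_mul; case: (boolP (A \in faces Q 0)) => A0; last first.
      rewrite face_coord_notin // /face_map big1 // => y yA.
      rewrite face_coord_notin ?mulr0 //; apply: contra A0; exact: faces_setU1.
    have -> : A = set0 by move: A0; rewrite inE => /andP [_]; rewrite cards_eq0 => /eqP.
    rewrite map0; last by move=> B; apply: face_coord_notin.
    by rewrite e; apply: eq_bigr => y yQ; rewrite face_rowK // fE.
  rewrite face_coord_mul map0; last by move=> B; apply: face_coord_notin.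
  by apply/I_gen; eexists.
- move=> i u; split=> [du|[v ->]].
    have df A : face_map taylor_coef (face_coord u) A = 0.
      by rewrite -face_coord_mul du face_coord0.
    have [g sg0 dg] := taylor_exact (fun B => @face_coord_notin _ Q _ _ u B) df.
    exists (face_row Q i.+2 g); apply: face_rowP => A.
    rewrite face_coord_mul -dg; apply: eq_bigr => y _; congr (_ * _).
    by rewrite face_rowK.
  apply: face_rowP => A; rewrite face_coord_mul.
  rewrite face_coord0 -[RHS](taylor_map2 (face_coord v) A); apply: eq_bigr => y _.
  by rewrite face_coord_mul.
Qed.
End Taylor.

(** * Independence of the resolution *)

Section HomogeneousParts.
Variables (k : fieldType) (n : nat).
Local Notation R := {mpoly k[n]}.
Implicit Types (p q : R) (d e : int) (M : 'X_{1..n}).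

Definition homog_part d p : R :=
  \sum_(M <- msupp p | (mdeg M)%:Z == d) p@_M *: 'X_[M].

Lemma mcoeff_homog_part d p M :
  (homog_part d p)@_M = if (mdeg M)%:Z == d then p@_M else 0.
Proof.
rewrite raddf_sum /= -big_filter.
have term N : (p@_N *: 'X_[N])@_M = if N == M then p@_M else 0.
  by rewrite mcoeffZ mcoeffX; case: eqP => [->|]; rewrite ?mulr1 ?mulr0.
rewrite (eq_bigr _ (fun N _ => term N)) -big_mkcond big_filter_cond /=.
case: ifP => dM; last first.
  by rewrite big_pred0 // => N; case: (N =P M) => [->|]; rewrite ?dM ?andbF.
case: (boolP (M \in msupp p)) => Mp; last first.
  by rewrite memN_msupp_eq0 // big1.
rewrite (big_rem M) //= dM eqxx big1_seq ?addr0 // => N /andP [/andP [_ /eqP ->]].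
by rewrite mem_rem_uniq ?msupp_uniq // inE eqxx.
Qed.

Lemma homog_partP d p : homog_of_degree d (homog_part d p).
Proof.
move=> M; rewrite mcoeff_msupp mcoeff_homog_part.
by case: (_ =P d) => //; rewrite eqxx.
Qed.

Lemma homog_part_id d p : homog_of_degree d p -> homog_part d p = p.
Proof.
move=> h; apply/mpolyP => M; rewrite mcoeff_homog_part; case: eqP => // ne.
by apply/esym/memN_msupp_eq0/negP => /h.
Qed.

Lemma homog_partB d : {morph homog_part d : p q / p - q}.
Proof.
move=> p q; apply/mpolyP => M; rewrite mcoeffB !mcoeff_homog_part mcoeffB.
by case: eqP => // _; rewrite subr0.
Qed.

Lemma homog_part_sum d (J : Type) (s : seq J) (P : pred J) (F : J -> R) :
  homog_part d (\sum_(x <- s | P x) F x) = \sum_(x <- s | P x) homog_part d (F x).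
Proof.
apply/mpolyP => M; rewrite mcoeff_homog_part !(raddf_sum (mcoeff M)).
case: ifP => h; last rewrite big1 //; [apply: eq_bigr|] => x _;
  by rewrite /= mcoeff_homog_part h.
Qed.

Lemma mcoeff_mul_neq0 p q M : (p * q)@_M != 0 ->
  exists M1 M2, [/\ p@_M1 != 0, q@_M2 != 0 & M = (M1 + M2)%MM].
Proof.
rewrite -mcoeff_msupp => /msuppM_le /allpairsP [[M1 M2]] /= [h1 h2 ->].
by exists M1, M2; split; rewrite -?mcoeff_msupp.
Qed.

Lemma homog_ofP d p : homog_of_degree d p <-> forall M, p@_M != 0 -> (mdeg M)%:Z = d.
Proof. by split=> h M; move: (h M); rewrite mcoeff_msupp. Qed.

Lemma homog_ofM d e p q : homog_of_degree d p -> homog_of_degree e q ->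
  homog_of_degree (d + e) (p * q).
Proof.
move=> /homog_ofP hp /homog_ofP hq; apply/homog_ofP => M.
move=> /mcoeff_mul_neq0 [M1 [M2 [/hp <- /hq <- ->]]].
by rewrite mdegD PoszD.
Qed.

Lemma homog_of_sum d (J : Type) (s : seq J) (P : pred J) (F : J -> R) :
  (forall x, P x -> homog_of_degree d (F x)) ->
  homog_of_degree d (\sum_(x <- s | P x) F x).
Proof.
move=> h; rewrite -(eq_bigr _ (fun x Px => homog_part_id (h x Px))).
by rewrite -homog_part_sum; apply: homog_partP.
Qed.

Lemma homog_partMr d e p q : homog_of_degree e q ->
  homog_part d (p * q) = homog_part (d - e) p * q.
Proof.
move=> hq; rewrite -{1}(subrK (homog_part (d - e) p) p) mulrDl.
have h0 : homog_part d ((p - homog_part (d - e) p) * q) = 0.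
  apply/mpolyP => M; rewrite mcoeff_homog_part mcoeff0; case: eqP => // dM.
  apply/eqP; apply: contraT => /mcoeff_mul_neq0 [M1 [M2 [h1 /(proj1 (homog_ofP e q) hq) e2 e1]]].
  move: h1; rewrite mcoeffB mcoeff_homog_part.
  by rewrite -dM -e2 e1 mdegD PoszD addrK eqxx subrr eqxx.
rewrite -[_ + homog_part _ _ * q](addrC) -[X in X + _]opprK addrC homog_partB h0 sub0r.
rewrite homog_part_id ?opprK //.
rewrite -mulNr -[d](subrK e); apply: homog_ofM hq.
apply/homog_ofP => M; rewrite mcoeffN oppr_eq0 mcoeff_homog_part.
by rewrite addrK; case: (_ =P d - e) => //; rewrite eqxx.
Qed.

Definition homog_mx r s (a : 'I_r -> int) (b : 'I_s -> int) (A : 'M[R]_(r, s)) :=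
  forall i j, homog_of_degree (a i - b j) (A i j).

Lemma homog_mxM r s t (a : 'I_r -> int) (b : 'I_s -> int) (c : 'I_t -> int) A B :
  homog_mx a b A -> homog_mx b c B -> homog_mx a c (A *m B).
Proof.
move=> hA hB i j; rewrite mxE; apply: homog_of_sum => l _.
rewrite (_ : _ - _ = (a i - b l) + (b l - c j)); last by rewrite addrA subrK.
exact: homog_ofM.
Qed.

Lemma homog_mxB r s (a : 'I_r -> int) (b : 'I_s -> int) A B :
  homog_mx a b A -> homog_mx a b B -> homog_mx a b (A - B).
Proof.
move=> hA hB i j; rewrite !mxE.
rewrite -(homog_part_id (hA i j)) -(homog_part_id (hB i j)) -homog_partB.
exact: homog_partP.
Qed.

Lemma homog_mx1 r (a : 'I_r -> int) : homog_mx a a 1%:M.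
Proof.
move=> i j; rewrite mxE; case: eqP => [->|_] M.
  by rewrite subrr mulr1n msupp1 inE => /eqP ->; rewrite mdeg0.
by rewrite mulr0n msupp0.
Qed.

(** Exactness of a resolution is stated without grading; this turns the lifts it provides into maps
    of degree 0. *)
Lemma homog_lift r s t (a : 'I_r -> int) (b : 'I_s -> int) (c : 'I_t -> int)
    (X : 'M[R]_(r, s)) (D : 'M[R]_(s, t)) :
  homog_mx b c D -> exists2 X', homog_mx a b X' &
    forall i j, (X' *m D) i j = homog_part (a i - c j) ((X *m D) i j).
Proof.
move=> hD; exists (\matrix_(i, l) homog_part (a i - b l) (X i l)) => [i l|i j].
  by rewrite mxE; apply: homog_partP.
rewrite !mxE homog_part_sum; apply: eq_bigr => l _; rewrite mxE.
by rewrite (homog_partMr _ _ (hD l j)) opprB addrA subrK.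
Qed.
End HomogeneousParts.

(** Comparison maps and homotopies are built position by position, and a stage can be lifted only
    thanks to the invariant [P] of the previous one. *)
Lemma dependent_choice_seq (T : nat -> Type) (P : forall i, T i -> Prop)
    (E : forall i, T i -> T i.+1 -> Prop) (x0 : T 0%N) :
  P 0%N x0 ->
  (forall i x, P i x -> exists2 y, P i.+1 y & E i x y) ->
  exists2 f : forall i, T i, f 0%N = x0 & forall i, P i (f i) /\ E i (f i) (f i.+1).
Proof.
move=> h0 hS.
have hS' i (x : {x : T i | P i x}) : exists y : {y : T i.+1 | P i.+1 y}, E i (proj1_sig x) (proj1_sig y).
  by case: x => x Px; have [y Py Exy] := hS i x Px; exists (exist _ y Py).
pose next i x := proj1_sig (constructive_indefinite_description _ (hS' i x)).
pose f := nat_rect (fun i => {x : T i | P i x}) (exist _ x0 h0) next.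
exists (fun i => proj1_sig (f i)) => // i; split; first exact: (proj2_sig (f i)).
exact: (proj2_sig (constructive_indefinite_description _ (hS' i (f i)))).
Qed.

Record homogeneous_ideal (k : fieldType) (n : nat) (I : {mpoly k[n]} -> Prop) : Prop := {
  hidealB : forall p q, I p -> I q -> I (p - q);
  hidealMl : forall p q, I q -> I (p * q);
  hideal_part : forall d p, I p -> I (homog_part d p) }.

Lemma entryB (S : zmodType) r s (A B : 'M[S]_(r, s)) i j :
  (A - B) i j = A i j - B i j.
Proof. by rewrite !mxE. Qed.

Lemma mxrank_diff_eq0 (K : fieldType) r1 r2 s (A : 'M[K]_(r1, s)) (B : 'M_(r2, s)) :
  (\rank (A :\: B)%MS == 0%N) = (A <= B)%MS.
Proof.
have [_ e] := mxrank_leqif_sup (capmxSl A B).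
rewrite -(eqn_add2l (\rank (A :&: B)%MS)) mxrank_cap_compl addn0 eq_sym e.
by rewrite sub_capmx submx_refl.
Qed.

Section Comparison.
Variables (k : fieldType) (n : nat) (I : {mpoly k[n]} -> Prop).
Hypothesis hI : homogeneous_ideal I.
Local Notation R := {mpoly k[n]}.

Lemma hideal_sum (J : finType) (F : J -> R) :
  (exists p, I p) -> (forall x, I (F x)) -> I (\sum_x F x).
Proof.
move=> [p Ip] h; have I0 : I 0 by rewrite -(subrr p); apply: hidealB.
elim/big_ind: _ => // a b Ia Ib; rewrite -[b]opprK; apply: hidealB => //.
by rewrite -sub0r; apply: hidealB.
Qed.

(** At position 0 the target is R/I, where vanishing means lying in [I]; lifting is then uniform in
    the position. *)
Definition cycle_rows (F : free_seq k n) i : forall r, 'M[R]_(r, fr_rank F i) -> Prop :=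
  match i with
  | 0 => fun r A => forall x, I ((A *m fr_aug F) x 0)
  | i'.+1 => fun r A => A *m fr_diff F i' = 0
  end.

Section OneResolution.
Variable F : free_seq k n.
Hypothesis rF : is_graded_free_resolution I F.

Lemma cycle_rows_lift i r (a : 'I_r -> int) (A : 'M[R]_(r, fr_rank F i)) :
  homog_mx a (@fr_deg _ _ F i) A -> cycle_rows A ->
  exists2 X, homog_mx a (@fr_deg _ _ F i.+1) X & A = X *m fr_diff F i.
Proof.
move=> hA cA.
have lift x : exists v, row x A = v *m fr_diff F i.
  case: i A hA cA => [|i] A hA cA.
    apply/(res_exact0 rF); rewrite -row_mul mxE; exact: cA.
  by apply/(res_exact rF); rewrite -row_mul cA row0.
have {lift} [v vP] := fin_all_exists lift.
have eA : A = (\matrix_x v x) *m fr_diff F i.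
  by apply/row_matrixP => x; rewrite row_mul rowK vP.
have [X hX XP] := homog_lift a (\matrix_x v x) (res_diff_homog rF (i := i)).
exists X => //; apply/matrixP => x y; rewrite XP -eA.
by rewrite homog_part_id.
Qed.

Lemma diff_cycle_rows i : cycle_rows (fr_diff F i).
Proof.
case: i => [|i] /=.
  move=> x.
  have : I ((row x (fr_diff F 0) *m fr_aug F) 0 0).
    by apply/(res_exact0 rF); exists (delta_mx 0 x); rewrite rowE.
  by rewrite -row_mul mxE.
apply/row_matrixP => x; rewrite row0 row_mul.
by apply/(res_exact rF); exists (delta_mx 0 x); rewrite rowE.
Qed.
End OneResolution.

Lemma chain_map_exists (F G : free_seq k n) :
  is_graded_free_resolution I F -> is_graded_free_resolution I G ->
  exists f : forall i, 'M[R]_(fr_rank F i, fr_rank G i),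
   [/\ forall i, homog_mx (@fr_deg _ _ F i) (@fr_deg _ _ G i) (f i),
       forall x, I ((fr_aug F - f 0%N *m fr_aug G) x 0) &
       forall i, fr_diff F i *m f i = f i.+1 *m fr_diff G i].
Proof.
move=> rF rG.
have aug x : exists u : 'rV_(fr_rank G 0), I (fr_aug F x 0 - (u *m fr_aug G) 0 0).
  exact: (res_aug_surj rG).
have [u uP] := fin_all_exists aug.
have hG0 : homog_mx (@fr_deg _ _ G 0) (fun=> 0) (fr_aug G).
  by move=> i j; rewrite subr0 ord1; apply: (res_aug_homog rG).
have [f0 hf0 f0E] := homog_lift (@fr_deg _ _ F 0) (\matrix_x u x) hG0.
have af0 x : I ((fr_aug F - f0 *m fr_aug G) x 0).
  rewrite entryB f0E subr0.
  rewrite -(homog_part_id (res_aug_homog rF (c := x))) -homog_partB.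
  apply: hideal_part => //.
  have -> : ((\matrix_x u x) *m fr_aug G) x 0 = (u x *m fr_aug G) 0 0.
    by rewrite -(rowK u x) -row_mul [RHS]mxE.
  exact: uP.
pose P i (f : 'M[R]_(fr_rank F i, fr_rank G i)) :=
  homog_mx (@fr_deg _ _ F i) (@fr_deg _ _ G i) f /\ cycle_rows (fr_diff F i *m f).
have P0 : P 0%N f0.
  split=> // x; rewrite -mulmxA.
  have -> : (fr_diff F 0 *m (f0 *m fr_aug G)) x 0 =
      (fr_diff F 0 *m fr_aug F) x 0
      - \sum_l fr_diff F 0 x l * (fr_aug F - f0 *m fr_aug G) l 0.
    rewrite !mxE -sumrB; apply: eq_bigr => l _.
    by rewrite entryB -mulrBr opprB addrC subrK.
  apply: (hidealB hI); first exact: (diff_cycle_rows rF 0).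
  apply: hideal_sum => [|l]; last exact: (hidealMl hI).
  by exists ((fr_diff F 0 *m fr_aug F) x 0); apply: (diff_cycle_rows rF 0).
have PS i f : P i f -> exists2 g, P i.+1 g & fr_diff F i *m f = g *m fr_diff G i.
  move=> [hf cf].
  have [g hg eg] := cycle_rows_lift rG (homog_mxM (res_diff_homog rF (i := i)) hf) cf.
  exists g => //; split=> //=.
  by rewrite -mulmxA -eg mulmxA (diff_cycle_rows rF i.+1) mul0mx.
have [f e0 fP] := dependent_choice_seq P0 PS.
exists f; split=> [i|x|i]; [exact: (fP i).1.1 | by rewrite e0 | exact: (fP i).2].
Qed.

(** An endomorphism lifting the identity of R/I is homotopic to the identity: what remains of the
    difference after the previous homotopy is a cycle, hence lifts. *)
Lemma homotopy_exists (F : free_seq k n)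
    (e : forall i, 'M[R]_(fr_rank F i)) :
  is_graded_free_resolution I F ->
  (forall i, homog_mx (@fr_deg _ _ F i) (@fr_deg _ _ F i) (e i)) ->
  (forall x, I ((fr_aug F - e 0%N *m fr_aug F) x 0)) ->
  (forall i, fr_diff F i *m e i = e i.+1 *m fr_diff F i) ->
  exists s : forall i, 'M[R]_(fr_rank F i, fr_rank F i.+1),
   [/\ forall i, homog_mx (@fr_deg _ _ F i) (@fr_deg _ _ F i.+1) (s i),
       1%:M - e 0%N = s 0%N *m fr_diff F 0 &
       forall i, 1%:M - e i.+1 = fr_diff F i *m s i + s i.+1 *m fr_diff F i.+1].
Proof.
move=> rF he ae ce.
have h1 i := homog_mxB (@homog_mx1 _ _ _ (@fr_deg _ _ F i)) (he i).
have c0 : cycle_rows (1%:M - e 0%N) by move=> x; rewrite mulmxBl mul1mx.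
have [s0 hs0 s0E] := cycle_rows_lift rF (h1 0%N) c0.
pose P i (s : 'M[R]_(fr_rank F i, fr_rank F i.+1)) :=
  homog_mx (@fr_deg _ _ F i) (@fr_deg _ _ F i.+1) s /\
  cycle_rows (1%:M - e i.+1 - fr_diff F i *m s).
have P0 : P 0%N s0.
  split=> //=; rewrite mulmxBl -mulmxA -s0E mulmxBl mulmxBr mul1mx mulmx1 ce.
  by rewrite subrr.
have PS i s : P i s -> exists2 s', P i.+1 s' &
    1%:M - e i.+1 - fr_diff F i *m s = s' *m fr_diff F i.+1.
  move=> [hs cs].
  have hm := homog_mxB (h1 i.+1) (homog_mxM (res_diff_homog rF (i := i)) hs).
  have [s' hs' es'] := cycle_rows_lift rF hm cs.
  exists s' => //; split=> //=.
  rewrite mulmxBl -mulmxA -es' !mulmxBr mulmxA (diff_cycle_rows rF i.+1) mul0mx.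
  by rewrite mulmxBl mul1mx mulmx1 ce subr0 subrr.
have [s e0 sP] := dependent_choice_seq P0 PS.
exists s; split=> [i||i]; [exact: (sP i).1.1 | by rewrite e0 |].
by rewrite -(sP i).2 [RHS]addrC subrK.
Qed.

Definition residue r s (A : 'M[R]_(r, s)) : 'M[k]_(r, s) :=
  map_mx (mcoeff 0%MM) A.

Definition of_degree (F : free_seq k n) i (j : int) (u : 'rV[k]_(fr_rank F i)) :=
  forall l, u 0 l != 0 -> fr_deg l = j.

(** A constant term can be nonzero only in an entry of degree 0, that is, between basis elements of
    equal degree. *)
Lemma of_degreeM (F G : free_seq k n) i i' j
    (A : 'M[R]_(fr_rank F i, fr_rank G i')) (u : 'rV[k]_(fr_rank F i)) :
  homog_mx (@fr_deg _ _ F i) (@fr_deg _ _ G i') A -> of_degree j u ->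
  of_degree j (u *m residue A).
Proof.
move=> hA hu l; rewrite mxE => h.
have /existsP [r hr] : [exists r, u 0 r * residue A r l != 0].
  apply: contraR h; rewrite negb_exists => /forallP h; rewrite big1 // => r _.
  by apply/eqP/negPn.
move: hr; rewrite mulf_eq0 negb_or mxE => /andP [/hu <- h0].
have := hA r l 0%MM; rewrite mcoeff_msupp => /(_ h0); rewrite mdeg0.
by move/eqP; rewrite eq_sym subr_eq0 => /eqP.
Qed.

Lemma of_degreeD (F : free_seq k n) i j (u v : 'rV[k]_(fr_rank F i)) :
  of_degree j u -> of_degree j v -> of_degree j (u + v).
Proof.
move=> hu hv l; rewrite mxE; case: (eqVneq (u 0 l) 0) => [->|/hu //].
by rewrite add0r; apply: hv.
Qed.

Lemma tens_degreeP (F : free_seq k n) i j (u : 'rV[k]_(fr_rank F i)) :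
  reflect (of_degree j u) (u <= tens_degree F i j)%MS.
Proof.
apply: (iffP submxP) => [[v ->] l|h].
  rewrite mul_mx_diag !mxE; case: (_ =P j) => // _; by rewrite mulr0 eqxx.
exists u; apply/rowP => l; rewrite mul_mx_diag !mxE.
case: (_ =P j) => [_|ne]; first by rewrite mulr1.
by rewrite mulr0; apply/eqP; apply: contraT => /h.
Qed.

Definition tens_cycle (F : free_seq k n) i (u : 'rV[k]_(fr_rank F i)) : Prop :=
  match i return 'rV[k]_(fr_rank F i) -> Prop with
  | 0 => fun=> True
  | i'.+1 => fun u => u *m tens_diff F i' = 0
  end u.

Lemma tens_cyclesP (F : free_seq k n) i (u : 'rV[k]_(fr_rank F i)) :
  (u <= tens_cycles F i)%MS <-> tens_cycle u.
Proof.
case: i u => [|i] u /=; first by split=> // _; apply: submx1.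
by split=> [/sub_kermxP|/sub_kermxP].
Qed.

Lemma tens_boundaryP (F : free_seq k n) i j (u : 'rV[k]_(fr_rank F i)) :
  (u <= tens_degree F i.+1 j *m tens_diff F i)%MS <->
  exists2 v, of_degree j v & u = v *m tens_diff F i.
Proof.
split=> [/submxP [v ->]|[v /tens_degreeP hv ->]]; last exact: submxMr.
exists (v *m tens_degree F i.+1 j); last by rewrite mulmxA.
by apply/tens_degreeP/submxMl.
Qed.

Lemma tens_homology_dimP (F : free_seq k n) i j :
  tens_homology_dim F i j <> 0%N <-> exists u : 'rV[k]_(fr_rank F i),
    [/\ of_degree j u, tens_cycle u &
      ~~ (u <= tens_degree F i.+1 j *m tens_diff F i)%MS].
Proof.
rewrite /tens_homology_dim; split=> [|[u [hu cu nu]]] h.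
  have /row_subPn [x hx] : ~~ (tens_degree F i j :&: tens_cycles F i <=
      tens_degree F i.+1 j *m tens_diff F i)%MS.
    by apply/negP => s; apply: h; apply/eqP; rewrite mxrank_diff_eq0.
  have := row_sub x (tens_degree F i j :&: tens_cycles F i)%MS.
  rewrite sub_capmx => /andP [/tens_degreeP h1 /tens_cyclesP h2].
  by exists (row x (tens_degree F i j :&: tens_cycles F i)%MS).
move/eqP: h; rewrite mxrank_diff_eq0 => h; case/negP: nu.
apply: submx_trans h; rewrite sub_capmx; apply/andP; split; first exact/tens_degreeP.
exact/tens_cyclesP.
Qed.

Theorem tens_homology_independent (F G : free_seq k n) i j :
  is_graded_free_resolution I F -> is_graded_free_resolution I G ->
  tens_homology_dim F i j <> 0%N -> tens_homology_dim G i j <> 0%N.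
Proof.
move=> rF rG /tens_homology_dimP [u [hu cu nu]].
have [f [hf af cf]] := chain_map_exists rF rG.
have [g [hg ag cg]] := chain_map_exists rG rF.
pose e i := f i *m g i.
have he i' : homog_mx (@fr_deg _ _ F i') (@fr_deg _ _ F i') (e i').
  exact: homog_mxM (hf i') (hg i').
have ce i' : fr_diff F i' *m e i' = e i'.+1 *m fr_diff F i'.
  by rewrite /e mulmxA cf -!mulmxA cg.
have ae x : I ((fr_aug F - e 0%N *m fr_aug F) x 0).
  have -> : fr_aug F - e 0%N *m fr_aug F = (fr_aug F - f 0%N *m fr_aug G)
     - (- (f 0%N *m (fr_aug G - g 0%N *m fr_aug F))).
    by rewrite opprK mulmxBr addrA subrK mulmxA.
  rewrite entryB; apply: (hidealB hI) => //.
  rewrite -sub0r entryB mxE.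
  have I0 : I 0 by rewrite -(subrr ((fr_aug F - f 0%N *m fr_aug G) x 0)); apply: (hidealB hI).
  apply: (hidealB hI) => //; rewrite mxE; apply: hideal_sum => [|l]; first by exists 0.
  exact: (hidealMl hI).
have [s [hs s0 sS]] := homotopy_exists rF he ae ce.
have resM r t l (A : 'M[R]_(r, t)) (B : 'M_(t, l)) :
  residue (A *m B) = residue A *m residue B by apply: map_mxM.
apply/tens_homology_dimP; exists (u *m residue (f i)); split.
- exact: of_degreeM.
- case: i u {hu nu} cu => //= i u cu.
  rewrite /tens_diff -!mulmxA -/(residue _) -resM -cf resM mulmxA.
  by rewrite cu mul0mx.
apply: contra nu => /tens_boundaryP [v hv ev]; apply/tens_boundaryP.
exists (v *m residue (g i.+1) + u *m residue (s i)).
  by apply: of_degreeD; apply: of_degreeM.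
(* If the image of [u] under [f] is a boundary, applying [g] makes the first summand one; the
   homotopy makes the second one, its extra term in positive positions vanishing because [u] is a
   cycle. *)
have eu : u = u *m residue (e i) + u *m residue (1%:M - e i).
  by rewrite -mulmxDr /residue map_mxB addrC subrK map_mx1 mulmx1.
rewrite {1}eu mulmxDl; congr (_ + _).
  rewrite /e resM mulmxA ev /tens_diff -!mulmxA -!/(residue _) -!resM.
  by rewrite cg.
case: i u s sS cu {hu eu ev v hv hs} => [|i] u s sS cu in s0 *.
  by rewrite s0 resM mulmxA.
rewrite sS /residue map_mxD mulmxDr -!/(residue _) !resM !mulmxA.
by rewrite cu mul0mx add0r.
Qed.
End Comparison.

(** * Betti numbers from the Taylor resolution *)

Section TaylorTensor.
Variables (k : fieldType) (V Z : finType) (Q : {set Z}) (m : Z -> {set V}).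
Implicit Types (A B : {set Z}).

(** Modulo the variables only an lcm quotient equal to 1 survives, so the complex splits into the
    families [lcm_fiber Q m W]. *)
Definition residue_coef (y : Z) A : k :=
  if lcm_set m (y |: A) == lcm_set m A then sg k y A else 0.

Lemma tens_diff_taylor i :
  tens_diff (taylor k Q m) i = face_mx Q residue_coef i.
Proof.
apply/matrixP => r c; rewrite !mxE raddf_sum; apply: eq_bigr => y _.
rewrite /taylor_coef /residue_coef /= mcoeffZ mcoeffX.
rewrite -mdeg_eq0 mdeg_set_mnm cards_eq0 setD_eq0 eqEsubset.
rewrite (lcm_setS m (subsetU1 _ _)) andbT.
by case: ifP; rewrite ?mulr1 ?mulr0.
Qed.

Lemma face_mx_mulr t i (phi : 'cV[k]_#|faces Q i|) r :
  (face_mx Q t i *m phi) r 0 = \sum_(y in face r)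
    t y (face r :\ y) * face_coord phi^T (face r :\ y).
Proof.
rewrite mxE; under eq_bigr do rewrite mxE big_distrl /=.
rewrite (exchange_big_dep (fun y => y \in face r)) /=; last by move=> ? ? _ /andP [].
apply: eq_bigr => y yr.
have Di : face r :\ y \in faces Q i.
  by apply: (@faces_setU1 _ _ y); rewrite ?setD1K // ?inE ?eqxx //; have := enum_valP r; rewrite inE.
rewrite -(enum_rankK_in Di Di) -/(face _) face_coordE mxE; set c := enum_rank_in _ _.
rewrite (big_pred1 c) // => d; rewrite yr /=.
by rewrite (inj_eq enum_val_inj).
Qed.

Lemma row_col_pairing i (u : 'rV[k]_#|faces Q i|) (phi : 'cV[k]_#|faces Q i|) :
  (u *m phi) 0 0 = \sum_A face_coord phi^T A * face_coord u A.
Proof.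
rewrite mxE (bigID (mem (faces Q i))) /= [X in _ = _ + X]big1 ?addr0; last first.
  by move=> A Ai; rewrite face_coord_notin // mul0r.
rewrite [RHS]big_enum_val; apply: eq_bigr => l _.
by rewrite -/(face l) !face_coordE mxE mulrC.
Qed.

Lemma tens_cycle_taylor i (u : 'rV[k]_#|faces Q i|) A :
  @tens_cycle k #|V| (taylor k Q m) i u -> face_map residue_coef (face_coord u) A = 0.
Proof.
case: i u => [|i] u cu; last first.
  by rewrite -face_coord_mul -tens_diff_taylor cu face_coord0.
rewrite /face_map big1 // => y yA; rewrite face_coord_notin ?mulr0 //.
by rewrite inE cardsU1 yA andbF.
Qed.

(** A class that is not a boundary is detected by a functional killing boundaries, a column of the
    cokernel. Its pairing with the cycle splits over the unions [W], and some summand is nonzero. *)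
Lemma taylor_homology_nonacyclic i j :
  tens_homology_dim (taylor k Q m) i j <> 0%N ->
  exists W : {set V}, #|W|%:Z = j /\ nonacyclic k (lcm_fiber Q m W) i.
Proof.
case/tens_homology_dimP => u [hu cu]; set M := (_ *m _); rewrite submxE => nu.
have [c hc] : exists c, (u *m cokermx M) 0 c != 0.
  apply/existsP; apply: contraR nu; rewrite negb_exists => /forallP h.
  by apply/eqP/rowP => c; rewrite [RHS]mxE; apply/eqP/negPn.
pose phi : 'cV[k]_#|faces Q i| := cokermx M *m delta_mx c 0.
have Mphi : M *m phi = 0 by rewrite mulmxA mulmx_coker mul0mx.
have : (u *m phi) 0 0 != 0 by rewrite mulmxA -colE mxE.
rewrite row_col_pairing; set z := face_coord u; set p := face_coord phi^T => n.
have [W hW] : exists W, \sum_(A | lcm_set m A == W) p A * z A != 0.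
  apply/existsP; apply: contraR n; rewrite negb_exists => /forallP h.
  rewrite (partition_big (lcm_set m) xpredT) //= big1 // => W _.
  by apply/eqP/negPn.
have zi A : z A != 0 -> A \in faces Q i.
  by apply: contraNT => nA; rewrite /z face_coord_notin.
have pi A : p A != 0 -> A \in faces Q i.
  by apply: contraNT => nA; rewrite /p face_coord_notin.
have Wj : #|W|%:Z = j.
  have /existsP [A /andP [/eqP <- zA]] : [exists A, (lcm_set m A == W) && (z A != 0)].
    apply: contraR hW; rewrite negb_exists => /forallP h; rewrite big1 // => A AW.
    by move: (h A); rewrite AW negbK => /eqP ->; rewrite mulr0.
  have Ai := zi A zA.
  have := hu (enum_rank_in Ai A).
  rewrite -face_coordE /face /= /face enum_rankK_in //; exact.
exists W; split=> //.
pose restr (f : {set Z} -> k) A := if lcm_set m A == W then f A else 0.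
have srestr f : (forall A, f A != 0 -> A \in faces Q i) ->
    supported (lcm_fiber Q m W) i (restr f).
  move=> sf A; rewrite /restr; case: ifP => [AW /sf|_]; last by rewrite eqxx.
  by rewrite inE /lcm_fiber => /andP [-> ->]; rewrite -/(lcm_set m A) AW.
exists (restr z), (restr p); split; try exact: srestr.
- move=> A /andP [AQ /eqP AW].
  rewrite -[RHS](tens_cycle_taylor A cu); apply: eq_bigr => y yA.
  rewrite /restr /residue_coef -[lcm_set m A]/(\bigcup_(x in A) m x) AW.
  by case: ifP => _; rewrite ?mulr0 ?mul0r.
- move=> B /andP [BQ /eqP BW].
  case: (boolP (B \in faces Q i.+1)) => Bi; last first.
    rewrite /cobd big1 // => y yB.
    case: (eqVneq (restr p (B :\ y)) 0) => [->|]; first by rewrite mulr0.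
    case/(srestr p pi)/andP => _ s; case/negP: Bi; rewrite inE BQ (cardsD1 y B) yB.
    by rewrite add1n eqSS.
  pose r := enum_rank_in Bi B.
  have rB : face r = B by rewrite /face enum_rankK_in.
  have : (tens_diff (taylor k Q m) i *m phi) r 0 = 0.
    have := congr1 (fun X : 'cV[k]__ => X r 0) Mphi.
    rewrite /M -mulmxA mul_diag_mx mxE [(\row_l _) 0 r]mxE [RHS]mxE /= rB.
    by rewrite -[lcm_set m B]/(\bigcup_(x in B) m x) BW Wj eqxx mul1r.
  rewrite tens_diff_taylor face_mx_mulr rB => e; rewrite -[RHS]e.
  apply: eq_bigr => y yB; rewrite /residue_coef setD1K // /restr.
  rewrite -[lcm_set m B]/(\bigcup_(x in B) m x) BW eq_sym sg_setD1id.
  by case: ifP => _; rewrite ?mulr0 ?mul0r.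
- rewrite (bigID (fun A => lcm_set m A == W)) /= [X in _ + X]big1 ?addr0.
    rewrite (eq_bigr (fun A => p A * z A)) // => A AW.
    by rewrite /restr AW.
  by move=> A /negbTE AW; rewrite /restr AW mul0r.
Qed.

(** Pairing with [p] kills every boundary, because [p] is a cocycle on the fibre of [W] and
    [residue_coef] vanishes between different fibres. *)
Lemma nonacyclic_taylor_homology i (W : {set V}) :
  nonacyclic k (lcm_fiber Q m W) i ->
  tens_homology_dim (taylor k Q m) i #|W|%:Z <> 0%N.
Proof.
move=> [z [p [sz sp bz cp n]]].
have lcmE A : \bigcup_(x in A) m x = lcm_set m A by [].
have notin (f : {set Z} -> k) : supported (lcm_fiber Q m W) i f -> forall A, A \notin faces Q i -> f A = 0.
  move=> sf A Ai; apply/eqP; apply: contraT => /sf /andP [/andP [AQ _] Ac].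
  by rewrite inE AQ Ac in Ai.
have inW (f : {set Z} -> k) A : supported (lcm_fiber Q m W) i f -> f A != 0 -> lcm_set m A = W.
  by move=> sf /sf /andP [/andP [_ /eqP]].
apply/tens_homology_dimP; exists (face_row Q i z); split.
- by move=> l; rewrite mxE => /(inW z _ sz) /= ->.
- case: i z p {n cp sp} sz bz notin inW => //= i z _ sz bz notin inW.
  apply: face_rowP => A; rewrite tens_diff_taylor face_coord_mul face_coord0.
  rewrite /face_map (eq_bigr (fun y => residue_coef y A * z (y |: A))); last first.
    by move=> y _; rewrite face_rowK //; apply: notin.
  case: (boolP (lcm_fiber Q m W A)) => AF.
    rewrite -[RHS](bz _ AF); apply: eq_bigr => y yA; rewrite /residue_coef.
    case: (eqVneq (z (y |: A)) 0) => [->|/(inW z _ sz) ->]; first by rewrite !mulr0.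
    by case/andP: AF => _ /eqP; rewrite lcmE => ->; rewrite eqxx.
  rewrite big1 // => y yA; rewrite /residue_coef.
  case: (eqVneq (z (y |: A)) 0) => [->|zn]; first by rewrite mulr0.
  case: eqP => [e|]; last by rewrite mul0r.
  case/negP: AF; rewrite /lcm_fiber lcmE -e (inW z _ sz zn) eqxx andbT.
  case/andP: (sz _ zn) => /andP [h _] _; exact: subset_trans (subsetU1 _ _) h.
apply/negP => /tens_boundaryP [v _ ev].
case/eqP: n; transitivity ((face_row Q i z *m (face_row Q i p)^T) 0 0).
  rewrite row_col_pairing trmxK; apply: eq_bigr => A _.
  by rewrite !face_rowK //; apply: notin.
rewrite ev -mulmxA (_ : _ *m (face_row Q i p)^T = 0) ?mulmx0 ?mxE //.
apply/colP => r; rewrite tens_diff_taylor face_mx_mulr trmxK mxE.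
set B := face r.
rewrite (eq_bigr (fun y => residue_coef y (B :\ y) * p (B :\ y))); last first.
  by move=> y _; rewrite face_rowK //; apply: notin.
have BQ : B \subset Q by have := enum_valP r; rewrite inE => /andP [].
case: (eqVneq (lcm_set m B) W) => BW.
  rewrite -[RHS](cp B); last by rewrite /lcm_fiber BQ lcmE BW /=.
  apply: eq_bigr => y yB; rewrite /residue_coef setD1K // sg_setD1id.
  case: (eqVneq (p (B :\ y)) 0) => [->|/(inW p _ sp) ->]; first by rewrite !mulr0.
  by rewrite BW eqxx.
rewrite big1 // => y yB; rewrite /residue_coef setD1K //.
case: (eqVneq (p (B :\ y)) 0) => [->|/(inW p _ sp) ->]; first by rewrite !mulr0.
by rewrite (negbTE BW) mul0r.
Qed.
End TaylorTensor.

(** * Nonvanishing Betti numbers of edge ideals *)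

Section MonomialIdeals.
Variables (k : fieldType) (V Z : finType) (Q : {set Z}) (m : Z -> {set V}).
Local Notation R := {mpoly k[#|V|]}.

Definition generated_by (p : R) :=
  exists c : Z -> R, p = \sum_(y in Q) c y * 'X_[set_mnm (m y)].

Lemma generated_by_homogeneous (I : R -> Prop) :
  (forall p, I p <-> generated_by p) -> homogeneous_ideal I.
Proof.
move=> e; split=> [p q /e [c ->] /e [c' ->]|p q /e [c ->]|d p /e [c ->]]; apply/e.
- exists (fun y => c y - c' y); rewrite -sumrB.
  by apply: eq_bigr => y _; rewrite mulrBl.
- exists (fun y => p * c y); rewrite mulr_sumr.
  by apply: eq_bigr => y _; rewrite mulrA.
exists (fun y => homog_part (d - (#|m y|)%:Z) (c y)).
rewrite homog_part_sum; apply: eq_bigr => y _; apply: homog_partMr => M.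
by rewrite msuppX inE => /eqP ->; rewrite mdeg_set_mnm.
Qed.
End MonomialIdeals.

Lemma edge_ideal_generated (k : fieldType) (H : hypergraph) (Z : finType)
    (Q : {set Z}) (m : Z -> {set hvertex H}) :
  {in Q &, injective m} -> m @: Q = hedges H ->
  forall p, @edge_ideal k H p <-> generated_by Q m p.
Proof.
move=> inj im p; split=> [[c ->]|[c ->]].
  exists (fun y => c (m y)); rewrite -im big_imset //=.
  by apply: eq_bigr => y _; rewrite edge_monomialE.
exists (fun F => \sum_(y in Q | m y == F) c y).
rewrite (partition_big m (fun F => F \in hedges H)) /=; last first.
  by move=> y yQ; rewrite -im imset_f.
apply: eq_bigr => F _; rewrite big_distrl /=.
by apply: eq_bigr => y /andP [_ /eqP <-]; rewrite edge_monomialE.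
Qed.

Section BettiNumbers.
Variables (k : fieldType) (H : hypergraph) (Z : finType)
  (Q : {set Z}) (m : Z -> {set hvertex H}).
Hypotheses (inj : {in Q &, injective m}) (im : m @: Q = hedges H).

Lemma betti_taylor i j : betti (@edge_ideal k H) i j <> 0%N <->
  tens_homology_dim (taylor k Q m) i j <> 0%N.
Proof.
have e := @edge_ideal_generated k H Z Q m inj im.
have rT := taylor_is_resolution e.
(* The Taylor resolution witnesses existence, so the resolution picked by [epsilon] really is
   one. *)
have rC : is_graded_free_resolution (@edge_ideal k H) (chosen_resolution (@edge_ideal k H)).
  by apply: epsilon_spec; exists (taylor k Q m).
have hI := generated_by_homogeneous e.
by split; apply: (tens_homology_independent hI).
Qed.

Lemma betti_nonacyclic i j : betti (@edge_ideal k H) i j <> 0%N <->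
  exists W : {set hvertex H}, #|W|%:Z = j /\ nonacyclic k (lcm_fiber Q m W) i.
Proof.
apply: iff_trans (betti_taylor i j) _; split; first exact: taylor_homology_nonacyclic.
by move=> [W [<- n]]; apply: nonacyclic_taylor_homology.
Qed.

Lemma betti_bounds i j : betti (@edge_ideal k H) i j <> 0%N ->
  (i <= #|Q|)%N /\ exists2 d : nat, j = d & (d <= #|hvertex H|)%N.
Proof.
case/betti_nonacyclic => W [<- /nonacyclic_size [B /andP [BQ _] <-]].
by split; [apply: subset_leq_card | exists #|W|; rewrite ?max_card].
Qed.

(** Makes the maximum defining [proj_dim] range over a nonempty set. As edges are nonempty, only the
    empty family has empty union. *)
Lemma betti00 : betti (@edge_ideal k H) 0 0 <> 0%N.
Proof.
apply/betti_nonacyclic; exists set0; split; first by rewrite cards0.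
pose f (A : {set Z}) : k := (A == set0)%:R.
have sf : supported (lcm_fiber Q m set0) 0 f.
  move=> A; rewrite /f; case: (A =P set0) => [->|]; last by rewrite eqxx.
  by rewrite /lcm_fiber sub0set big_set0 cards0 !eqxx.
exists f, f; split=> // [A _|A /andP [AQ /eqP A0]|].
- rewrite /bd big1 // => y _; rewrite /f; case: eqP => [e|]; last by rewrite mulr0.
  by have := setU11 y A; rewrite e inE.
- have -> : A = set0.
    apply/eqP; apply: contraT => /set0Pn [y yA].
    have yH : m y \in hedges H by rewrite -im imset_f // (subsetP AQ).
    have := hedges_ge2 yH; rewrite (_ : m y = set0) ?cards0 //.
    by apply/eqP; rewrite -subset0 -A0; apply: bigcup_sup.
  by rewrite /cobd big_set0.
- rewrite (bigD1 set0) //= big1 => [|A A0]; last by rewrite /f (negbTE A0) mul0r.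
  by rewrite /f eqxx mulr1 addr0 oner_neq0.
Qed.
End BettiNumbers.

(** A finite list containing [S] supplies the greatest element that [epsilon] needs; [S] is decided
    classically along the list. *)
Lemma max_ofP (d : Order.disp_t) (T : orderType d) (x0 : T) (S : T -> Prop) (s : seq T) :
  (exists x, S x) -> (forall x, S x -> x \in s) ->
  S (max_of x0 S) /\ forall x, S x -> (x <= max_of x0 S)%O.
Proof.
move=> ne Ss; apply: (epsilon_spec (inhabits x0) (fun m => S m /\ forall x, S x -> (x <= m)%O)).
elim: s S ne Ss => [|y s IH] S [x Sx] Ss; first by move: (Ss x Sx).
case: (excluded_middle_informative (exists2 t, S t & t != y)) => [[t St ty]|h].
  have ne' : exists u, S u /\ u != y by exists t.
  have Ss' u : S u /\ u != y -> u \in s.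
    by move=> [Su uy]; move: (Ss u Su); rewrite inE (negbTE uy).
  have [t' [[St' _] t'max]] := IH _ ne' Ss'.
  case: (excluded_middle_informative (S y)) => Sy; last first.
    exists t'; split=> // u Su; apply: t'max; split=> //.
    by apply: contra_notN Sy => /eqP <-.
  case: (leP y t') => yt.
    by exists t'; split=> // u Su; case: (eqVneq u y) => [->//|uy]; apply: t'max.
  exists y; split=> // u Su; case: (eqVneq u y) => [->//|uy].
  by apply: le_trans (ltW yt); apply: t'max.
have Sy u : S u -> u = y.
  by move=> Su; apply/eqP; apply: contraT => uy; case: h; exists u.
by exists x; split=> // u /Sy ->; rewrite (Sy x).
Qed.

(** * Both edge sets inside [incidence], and the inequality *)

Section Levi.
Variable H : hypergraph.

Lemma hedge_support_inj : {in hedge_index H &, injective (@hedge_support H)}.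
Proof.
move=> [[x|F]|t] [[y|E]|u]; rewrite !inE //= => _ _ /val_inj -> //.
Qed.

Lemma hedge_support_im : (@hedge_support H) @: hedge_index H = hedges H.
Proof.
apply/setP => F; apply/imsetP/idP => [[[[x|E]|t]]|FH]; rewrite ?inE //= => *.
  by subst F; apply: valP.
by exists (inl (inr (exist _ F FH))); rewrite ?inE.
Qed.

Lemma levi_edge_support_inj :
  {in levi_edge_index H &, injective (@levi_edge_support H)}.
Proof.
move=> [t|[x F]] [u|[y E]]; rewrite !inE //= => _ _ /setP e.
have := e (inl x); have := e (inr F); rewrite !inE ?eqxx /= ?eqxx ?orbT ?orbF.
by move=> /esym /eqP [->] /esym /eqP [->].
Qed.

Lemma levi_edge_support_im :
  (@levi_edge_support H) @: levi_edge_index H = hedges (levi H).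
Proof.
apply/setP => F; rewrite inE; apply/imsetP/existsP => [[[t|[x E]]]|[a /existsP [b]]].
- by rewrite inE.
- rewrite inE => xE ->; exists (inl x); apply/existsP; exists (inr E).
  by rewrite /= xE eqxx.
case: a b => [x|E] [y|E'] //= /andP [xE /eqP ->].
  by exists (inr (x, E')); rewrite ?inE.
by exists (inr (y, E)); rewrite ?inE //= setUC.
Qed.
End Levi.

Theorem corollary3p15 (k : fieldType) (H : hypergraph) (hH : simple_hypergraph H) :
  (proj_dim k H)%:Z <= reg k (levi H).
Proof.
have hb := betti_nonacyclic k (@hedge_support_inj H) (@hedge_support_im H).
have lb := @betti_nonacyclic k (levi H) _ _ _ (@levi_edge_support_inj H) (@levi_edge_support_im H).
(* The maximum is attained, so the projective dimension is itself an index with a nonzero Betti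
   number. *)
have [j bj] : exists j : int, betti (@edge_ideal k H) (proj_dim k H) j <> 0%N.
  have [] // := @max_ofP _ nat 0%N
    (fun i => exists j : int, betti (@edge_ideal k H) i j <> 0%N)
    (iota 0 (#|hedge_index H|.+1)).
    by exists 0%N, 0; apply: betti00 (@hedge_support_inj H) (@hedge_support_im H).
  move=> i [j /(betti_bounds (@hedge_support_inj H) (@hedge_support_im H)) [le _]].
  by rewrite mem_iota.
have [W [_ nW]] := (hb _ _).1 bj.
have [p [ep np]] := nonacyclic_levi nW.
have bl : betti (@edge_ideal k (levi H)) p #|induced_levi W|%:Z <> 0%N.
  by apply/lb; exists (induced_levi W).
(* The bounds on both indices confine their differences to a finite list, so [reg] is an upper bound
   for all of them. *)
have [] // := @max_ofP _ int 0
  (fun r => exists (i : nat) (j : int),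
    betti (@edge_ideal k (levi H)) i j <> 0%N /\ r = j - i%:Z)
  [seq d%:Z - i%:Z | d <- iota 0 (#|hvertex (levi H)|.+1), i <- iota 0 (#|levi_edge_index H|.+1)].
- by exists (#|induced_levi W|%:Z - p%:Z), p, #|induced_levi W|%:Z.
- move=> r [i [j' [/(@betti_bounds k (levi H) _ _ _ (@levi_edge_support_inj H) (@levi_edge_support_im H)) [le [d -> ld]] ->]]].
  by apply/allpairsP; exists (d, i); rewrite !mem_iota.
move=> _ /(_ (proj_dim k H)%:Z); apply.
exists p, #|induced_levi W|%:Z; split=> //.
by rewrite -ep PoszD addrAC subrr add0r.
Qed.
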